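(* Let $r \ge 1$ be an integer, let $\lambda_1,\ldots,\lambda_r,\alpha_1,\ldots,\alpha_r \in [0,1)$, and put $\mu_i := \sum_{j=1}^{i}\lambda_j$ for $1 \le i \le r$. Assume that $\mu_i \notin \mathbb{Z}$ for all $1 \le i \le r$. Then the multiple Lerch zeta function $L_r(\lambda_1,\ldots,\lambda_r;\alpha_1,\ldots,\alpha_r;s_1,\ldots,s_r)$, which is a holomorphic function of $(s_1,\ldots,s_r)$ on $U_r$, can be extended analytically to the whole of $\mathbb{C}^r$.
   Context: For $r \ge 1$ let $U_r := \{(s_1,\ldots,s_r)\in\mathbb{C}^r \mid \Re(s_1+\cdots+s_i) > i \text{ for all } 1\le i\le r\}$. For $(s_1,\ldots,s_r)\in U_r$ the multiple Lerch zeta function of depth $r$ is $$L_r(\lambda_1,\ldots,\lambda_r;\alpha_1,\ldots,\alpha_r;s_1,\ldots,s_r) := \sum_{n_1>\cdots>n_r>0}\frac{e(\lambda_1n_1)\cdots e(\lambda_rn_r)}{(n_1+\alpha_1)^{s_1}\cdots(n_r+\alpha_r)^{s_r}},$$ where the $n_i$ are integers and $e(a):=e^{2\pi\iota a}$ for $a\in\mathbb{R}$ (with $\iota=\sqrt{-1}$). The series converges normally on compact subsets of $U_r$. *)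

(* Defs.v *)
From HB Require Import structures.
From mathcomp Require Import all_boot all_order all_algebra.
From mathcomp Require Import all_classical all_reals all_analysis.
From mathcomp.analysis.showcase Require summability.
From mathcomp Require Export complex.

Set Implicit Arguments.
Unset Strict Implicit.
Unset Printing Implicit Defensive.

Import Order.TTheory GRing.Theory Num.Theory.
Import numFieldNormedType.Exports.

Local Open Scope classical_set_scope.
Local Open Scope complex_scope.
Local Open Scope ring_scope.

(* The library gives the topology and norm of a numFieldType K on the regular
   module K^o and on abstract K; R[i] itself needs this instance. *)
HB.instance Definition _ (R : rcfType) := NormedModule.copy R[i] R[i]^o.

Section ComplexExponential.
Context {R : realType}.
Implicit Types (z s : R[i]) (x a : R).

Definition cexp z : R[i] :=
  (expR (complex.Re z))%:C * (cos (complex.Im z) +i* sin (complex.Im z)).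

(* Principal value; only meant for x > 0 (the library has ln x = 0 otherwise). *)
Definition cpow x s : R[i] := cexp (s * (ln x)%:C).

Definition unit_e a : R[i] := cexp (0 +i* (2 * pi * a)).

End ComplexExponential.

(* The differential is taken over the field R[i], hence is C-linear.  The notion
   is meant for open D. *)
Definition holomorphic_on (R : realType) (r : nat) (D : set 'rV[R[i]]_r)
    (f : 'rV[R[i]]_r -> R[i]) : Prop :=
  forall s, D s -> differentiable f s.

Section MultipleLerch.
Context {R : realType} {r : nat}.
Implicit Types (lambda alpha : 'I_r -> R) (s : 'rV[R[i]]_r).

(* Ordinals are 0-based: the index i : 'I_r stands for i.+1. *)
Definition lerch_domain : set 'rV[R[i]]_r :=
  [set s | forall i : 'I_r,
     i.+1%:R < complex.Re (\sum_(j < r | (j <= i)%N) s ord0 j)].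

Definition decreasing_pos (n : {ffun 'I_r -> nat}) : bool :=
  [forall i : 'I_r, (0 < n i)%N] &&
  [forall i : 'I_r, forall j : 'I_r, (i < j)%N ==> (n j < n i)%N].

Definition lerch_term lambda alpha s (n : {ffun 'I_r -> nat}) : R[i] :=
  \prod_(i < r) (unit_e (lambda i * (n i)%:R)
                 / cpow ((n i)%:R + alpha i) (s ord0 i)).

(* The sum is unconditional: the limit of the partial sums along the finite
   sets of indices, directed by inclusion. *)
Definition lerch lambda alpha s : R[i] :=
  summability.sum
    (fun n : {n : {ffun 'I_r -> nat} | decreasing_pos n} =>
       lerch_term lambda alpha s (val n) : R[i]).

Definition partial_mu lambda (i : 'I_r) : R := \sum_(j < r | (j <= i)%N) lambda j.

End MultipleLerch.

(* Main.v *)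
From HB Require Import structures.
Require Import Defs.
From mathcomp Require Import all_boot all_order all_algebra.
From mathcomp Require Import finmap.
From mathcomp Require Import all_classical all_reals all_analysis.
From mathcomp Require Import ring lra zify.
Import Order.TTheory GRing.Theory Num.Theory.
Import numFieldNormedType.Exports.
Import Normc.
Local Open Scope classical_set_scope.
Local Open Scope ring_scope.

Set Implicit Arguments.
Unset Strict Implicit.

(* Sum the series from the outermost index n_1 inwards.  Call a sequence f a
   symbol if its k-th difference is O(m^(N-k)) for some N and all k; symbols
   form a ring containing (m+a)^(-s).  For |z| = 1, z <> 1, the equation
   g(m) = z (f(m+1) + g(m+1)), formally solved by g(m) = sum_k z^k f(m+k), has
   for every symbol f exactly one symbol solution: two solutions differ by a
   multiple of z^(-m), whose differences do not decay, and summation by parts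
   lowers the order of f until the series converges absolutely.  With
   z = e(mu_i) at the i-th step, this regularised summation makes sense of the
   iterated sum for every s, and on U_r it is the ordinary one.  No Cauchy
   theory is needed for holomorphy: around each s_0 all symbols
   are expanded as a constant, a linear and a quadratically small part in
   s - s_0, a decomposition preserved by products and by the summation. *)

(** On U_r only the sums Re(s_1 + ... + s_i) are controlled, and these are the exponents that arise
    when the largest index is summed first: the sum over n_1 > ... > n_i > m is O(m^-(Re(s_1 + ... +
    s_i) - i)). Summing away n_1, ..., n_i leaves e(mu_i m) times a symbol in m, and the next factor
    e(lambda_(i+1) n) turns mu_i into mu_(i+1); this is why the hypothesis concerns the mu_i. Off
    U_r there is no convergent series from which dependence on s could be read. Uniqueness takes its
    place: it makes the regularised sum linear. Existence is proved for weighted families, because a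
    bound by |h|^2 must come out of the summation as a bound by |h|^2. An order N - j is kept as a
    pair of natural numbers, so that it can be lowered to -2, where the series converges
    absolutely. *)

Section ComplexModulus.
Context {R : realType}.
Implicit Types x y z : R[i].

Lemma normcD x y : normc (x + y) <= normc x + normc y.
Proof. exact: le_normcD. Qed.

Lemma normcB x y : normc (x - y) <= normc x + normc y.
Proof. by rewrite -[normc y]normcN; exact: normcD. Qed.

Lemma normc_ge0 x : 0 <= normc x.
Proof. by case: x => a b; rewrite sqrtr_ge0. Qed.

Lemma normcX x n : normc (x ^+ n) = normc x ^+ n.
Proof.
elim: n => [|n IHn]; first by rewrite !expr0 (@normc1 R).
by rewrite !exprS normcM IHn.
Qed.

Lemma normc_sum (I : Type) (s : seq I) (P : pred I) (F : I -> R[i]) :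
  normc (\sum_(i <- s | P i) F i) <= \sum_(i <- s | P i) normc (F i).
Proof.
elim/big_rec2: _ => [|i a b _ le_ba]; first by rewrite (@normc0 R).
by apply: le_trans (normcD _ _) _; rewrite lerD2l.
Qed.

Lemma normc_prod (I : Type) (s : seq I) (P : pred I) (F : I -> R[i]) :
  normc (\prod_(i <- s | P i) F i) = \prod_(i <- s | P i) normc (F i).
Proof.
by elim/big_rec2: _ => [|i a b _ <-]; rewrite ?(@normc1 R) // normcM.
Qed.

Lemma Re_add x y : complex.Re (x + y) = complex.Re x + complex.Re y.
Proof. by case: x; case: y. Qed.
Lemma Im_add x y : complex.Im (x + y) = complex.Im x + complex.Im y.
Proof. by case: x; case: y. Qed.
Lemma Re_opp x : complex.Re (- x) = - complex.Re x.
Proof. by case: x. Qed.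
Lemma Im_opp x : complex.Im (- x) = - complex.Im x.
Proof. by case: x. Qed.
Lemma Re_mul x y : complex.Re (x * y) =
  complex.Re x * complex.Re y - complex.Im x * complex.Im y.
Proof. by case: x; case: y. Qed.
Lemma Im_mul x y : complex.Im (x * y) =
  complex.Re x * complex.Im y + complex.Im x * complex.Re y.
Proof. by case: x; case: y. Qed.

Lemma abs_Re_le x : `|complex.Re x| <= normc x.
Proof.
by case: x => a b /=; rewrite -sqrtr_sqr ler_wsqrtr // lerDl sqr_ge0.
Qed.

Lemma abs_Im_le x : `|complex.Im x| <= normc x.
Proof.
by case: x => a b /=; rewrite -sqrtr_sqr ler_wsqrtr // lerDr sqr_ge0.
Qed.

Lemma normc_le_ReIm x : normc x <= `|complex.Re x| + `|complex.Im x|.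
Proof.
case: x => a b /=; rewrite -[leRHS]ger0_norm ?addr_ge0 // -sqrtr_sqr.
rewrite ler_wsqrtr // sqrrD !real_normK ?num_real // addrAC lerDl.
by rewrite mulrn_wge0 ?mulr_ge0.
Qed.

Lemma normr_normc (x : R[i]) : `|x| = (normc x)%:C%C.
Proof. by case: x. Qed.

Lemma normc_real (a : R) : normc a%:C%C = `|a|.
Proof. by rewrite /= expr0n addr0 sqrtr_sqr. Qed.

Lemma normc_gt0 x : x != 0 -> 0 < normc x.
Proof.
move=> x0; rewrite lt_neqAle normc_ge0 andbT eq_sym.
by apply: contra x0 => /eqP/eq0_normc ->.
Qed.

End ComplexModulus.

(** * Limits of complex sequences *)

Section ComplexLimits.
Context {R : realType}.
Implicit Types (u v : nat -> R[i]) (l : R[i]).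

Definition clim u l := forall e : R, 0 < e ->
  exists n0, forall n, (n0 <= n)%N -> normc (u n - l) < e.

Lemma clim_cst l : clim (fun=> l) l.
Proof. by move=> e e0; exists 0%N => n _; rewrite subrr (@normc0 R). Qed.

Lemma clim_ext u v l : u =1 v -> clim u l -> clim v l.
Proof.
by move=> uv ul e /ul[n0 H]; exists n0 => n /H; rewrite uv.
Qed.

Lemma climD u v l l' : clim u l -> clim v l' -> clim (fun n => u n + v n) (l + l').
Proof.
move=> ul vl e e0; have e20 : 0 < e / 2 by rewrite divr_gt0.
have [n0 H0] := ul _ e20; have [n1 H1] := vl _ e20.
exists (maxn n0 n1) => n; rewrite geq_max => /andP[/H0 h0 /H1 h1].
have -> : u n + v n - (l + l') = (u n - l) + (v n - l') by ring.
by have := normcD (u n - l) (v n - l'); lra.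
Qed.

Lemma climZ c u l : clim u l -> clim (fun n => c * u n) (c * l).
Proof.
move=> ul e e0; have c0 := normc_ge0 c.
have [|n0 H0] := ul (e / (normc c + 1)); first by rewrite divr_gt0 //; lra.
exists n0 => n /H0; rewrite ltr_pdivlMr; last by lra.
by rewrite -mulrBr normcM; have := normc_ge0 (u n - l); lra.
Qed.

Lemma climB u v l l' : clim u l -> clim v l' -> clim (fun n => u n - v n) (l - l').
Proof.
move=> ul vl; apply: (@clim_ext (fun n => u n + -1 * v n)) => [n|].
  by rewrite mulN1r.
by rewrite -[- l']mulN1r; apply: climD => //; exact: climZ.
Qed.

Lemma clim_shift u l : clim u l -> clim (fun n => u n.+1) l.
Proof.
by move=> ul e /ul[n0 H]; exists n0 => n nn; apply: H; rewrite (leq_trans nn).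
Qed.

Lemma clim_normc_le u l B : clim u l -> (forall n, normc (u n) <= B) ->
  normc l <= B.
Proof.
move=> ul uB; apply/ler_addgt0Pr => e /ul[n0 /(_ n0 (leqnn _)) H].
have -> : l = u n0 - (u n0 - l) by ring.
by have := normcB (u n0) (u n0 - l); have := uB n0; lra.
Qed.

Lemma clim_unique u l l' : clim u l -> clim u l' -> l = l'.
Proof.
move=> ul ul'; apply/eqP; rewrite -subr_eq0; apply/eqP/eq0_normc/eqP.
rewrite eq_le normc_ge0 andbT.
have /(_ 0) := clim_normc_le (climB ul' ul); rewrite -[l' - l]opprB normcN.
by apply=> n; rewrite subrr (@normc0 R).
Qed.

(* Both [Re u + p] and [p] are nondecreasing and bounded. *)
Lemma clim_cauchy u (p : nat -> R) B :
  (forall n n', (n <= n')%N -> normc (u n' - u n) <= p n' - p n) ->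
  (forall n, p n <= B) -> exists l, clim u l.
Proof.
move=> up pB.
have part (f : R[i] -> R) : (forall x y, f (x - y) = f x - f y) ->
    (forall x, `|f x| <= normc x) -> exists a : R, (f \o u) @ \oo --> a.
  move=> fB f_le.
  have p_nd : {homo p : n m / (n <= m)%N >-> n <= m}.
    by move=> n m nm; rewrite -subr_ge0 (le_trans _ (up _ _ nm)) // normc_ge0.
  have /cvg_ex[a pa] : cvgn p.
    by apply: nondecreasing_is_cvgn => //; exists B => _ [n _ <-].
  have diff n m : (n <= m)%N -> `|f (u m) - f (u n)| <= p m - p n.
    by move=> nm; rewrite -fB (le_trans (f_le _)) // up.
  have /cvg_ex[b fpb] : cvgn (fun n => f (u n) + p n).
    apply: nondecreasing_is_cvgn => [n m nm|].
      by have := diff _ _ nm; rewrite ler_norml => /andP[]; lra.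
    exists (`|f (u 0%N)| + (B - p 0%N) + B) => _ [n _ <-].
    have := diff _ _ (leq0n n); rewrite ler_norml => /andP[_].
    by have := pB n; have := ler_norm (f (u 0%N)); lra.
  exists (b - a); have -> : f \o u = (fun n => f (u n) + p n) \- p.
    by apply/funext => n /=; lra.
  exact: cvgB.
have [a ua] := part _ (fun x y => etrans (Re_add x (- y)) (congr1 (+%R _) (Re_opp y)))
  (@abs_Re_le R).
have [b ub] := part _ (fun x y => etrans (Im_add x (- y)) (congr1 (+%R _) (Im_opp y)))
  (@abs_Im_le R).
exists (a +i* b)%C => e e0; have e20 : 0 < e / 2 by rewrite divr_gt0.
move/cvgrPdist_lt: ua => /(_ _ e20)[n0 _ Hn0].
move/cvgrPdist_lt: ub => /(_ _ e20)[n1 _ Hn1].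
exists (maxn n0 n1) => n; rewrite geq_max => /andP[n0n n1n].
apply: le_lt_trans (normc_le_ReIm _) _.
rewrite Re_add Im_add Re_opp Im_opp /= distrC [X in _ + X]distrC.
by have := Hn0 n n0n; have := Hn1 n n1n; rewrite /=; lra.
Qed.

End ComplexLimits.

(** * Symbols and regularised summation *)

Section Differences.
Context {R : realType}.
Implicit Types f g : nat -> R[i].

Definition dif f : nat -> R[i] := fun m => f m.+1 - f m.

Lemma iter_difD k f g m : iter k dif (fun m => f m + g m) m =
  iter k dif f m + iter k dif g m.
Proof. by elim: k m => //= k IHk m; rewrite /dif !IHk; ring. Qed.

Lemma iter_difZ k c f m : iter k dif (fun m => c * f m) m = c * iter k dif f m.
Proof. by elim: k m => //= k IHk m; rewrite /dif !IHk; ring. Qed.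

Lemma iter_dif_shift k f m : iter k dif (fun m => f m.+1) m = iter k dif f m.+1.
Proof. by elim: k m => //= k IHk m; rewrite /dif !IHk. Qed.

Lemma clim_dif f : clim f 0 -> clim (dif f) 0.
Proof. by move=> f0; rewrite -(subrr 0); apply: climB => //; exact: clim_shift. Qed.

(* Solutions [g] of [g m = z * (f m.+1 + g m.+1)] are unique in this class. *)
Definition tame f := exists k, clim (iter k dif f) 0.

Lemma tameB f g : tame f -> tame g -> tame (fun m => f m - g m).
Proof.
have mono h k k' : clim (iter k dif h) 0 -> clim (iter (k' + k) dif h) 0.
  by move=> hk; rewrite iterD; elim: k' => //= k' IH; exact: clim_dif.
move=> [k fk] [k' gk']; exists (k + k')%N.
apply: (@clim_ext _ (fun m => iter (k + k') dif f m - iter (k + k') dif g m)).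
  move=> m; have -> : (fun m => f m - g m) = (fun m => f m + -1 * g m).
    by apply/funext => n; ring.
  by rewrite iter_difD iter_difZ mulN1r.
by rewrite -(subrr 0); apply: climB; [rewrite addnC|]; exact: mono.
Qed.

Lemma tameZ c f : tame f -> tame (fun m => c * f m).
Proof.
move=> [k fk]; exists k; rewrite -(mulr0 c).
by apply: clim_ext (climZ c fk) => m; rewrite iter_difZ.
Qed.

(** Such an [f] is z^-m times a constant, and its k-th difference is (z^-1 - 1)^k f. The modulus of
    that is constant in m and, as z <> 1, nonzero unless [f] vanishes, so differencing never makes
    it tend to 0. *)
Lemma tame_geometric z f : normc z = 1 -> z != 1 -> tame f ->
  (forall m, f m = z * f m.+1) -> f =1 (fun=> 0).
Proof.
move=> z1 zn1 [k fk] fz.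
have z0 : z != 0.
  by apply: contra_eq_neq z1 => ->; rewrite (@normc0 R) eq_sym oner_eq0.
have fS m : f m.+1 = z^-1 * f m by rewrite (fz m) mulKf.
have difE n m : iter n dif f m = (z^-1 - 1) ^+ n * f m.
  elim: n m => [|n IHn] m; first by rewrite expr0 mul1r.
  by rewrite iterS /dif !IHn fS exprS; ring.
have f_norm m : normc (f m) = normc (f 0%N).
  by elim: m => // m <-; rewrite (fz m) normcM z1 mul1r.
have c0 : 0 < normc ((z^-1 - 1) ^+ k).
  by apply: normc_gt0; rewrite expf_neq0 // subr_eq0 invr_eq1.
suff f00 : normc (f 0%N) = 0.
  by move=> m; apply: eq0_normc; rewrite f_norm.
apply/eqP; rewrite eq_le normc_ge0 andbT leNgt; apply/negP => f0_gt0.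
have [n] := fk _ (mulr_gt0 c0 f0_gt0).
by move=> /(_ n (leqnn _)); rewrite subr0 difE normcM f_norm ltxx.
Qed.

End Differences.

Section Symbols.
Context {R : realType}.

(* [f] is a family of symbols of order [N - j], uniformly for [x] in [P] up to
   the weight [w x]. *)
Definition osymb (X : Type) (P : set X) (w : X -> R) (N j : nat)
    (f : X -> nat -> R[i]) := forall k, exists2 B : R, 0 <= B &
  forall x m, P x ->
    normc (iter k dif (f x) m) * m.+1%:R ^+ (k + j) <= B * w x * m.+1%:R ^+ N.

Definition symb X P w f := exists N, @osymb X P w N 0 f.

Section OneWeight.
Context {X : Type} (P : set X) (w : X -> R) (w_ge0 : forall x, 0 <= w x).
Implicit Types f g : X -> nat -> R[i].

Lemma osymb_ext N j f g : (forall x m, P x -> f x m = g x m) ->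
  osymb P w N j f -> osymb P w N j g.
Proof.
move=> fg fs k; have [B B0 HB] := fs k; exists B => // x m Px.
by have <- : f x = g x by [apply/funext => n; exact: fg]; exact: HB.
Qed.

Lemma osymb_weaken N N' j j' f : (N <= N')%N -> (j' <= j)%N ->
  osymb P w N j f -> osymb P w N' j' f.
Proof.
move=> NN jj fs k; have [B B0 HB] := fs k; exists B => // x m Px.
have m1 : 1 <= m.+1%:R :> R by rewrite ler1n.
apply: le_trans (_ : normc (iter k dif (f x) m) * m.+1%:R ^+ (k + j) <= _).
  by rewrite ler_wpM2l ?normc_ge0 // ler_weXn2l // leq_add2l.
by apply: le_trans (HB x m Px) _; rewrite ler_wpM2l ?mulr_ge0 // ler_weXn2l.
Qed.

Lemma osymbD N j f g : osymb P w N j f -> osymb P w N j g ->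
  osymb P w N j (fun x m => f x m + g x m).
Proof.
move=> fs gs k; have [B B0 HB] := fs k; have [B' B'0 HB'] := gs k.
exists (B + B'); first exact: addr_ge0.
move=> x m Px; rewrite iter_difD !mulrDl.
apply: le_trans (lerD (HB x m Px) (HB' x m Px)).
by rewrite -mulrDl ler_wpM2r ?exprn_ge0 // normcD.
Qed.

Lemma osymb_dif N j f : osymb P w N j f -> osymb P w N j.+1 (fun x => dif (f x)).
Proof.
move=> fs k; have [B B0 HB] := fs k.+1; exists B => // x m /(HB x m).
by rewrite -addSnnS iterSr.
Qed.

Lemma osymb_shift N j f : osymb P w N j f ->
  osymb P w N j (fun x m => f x m.+1).
Proof.
(* The power of 2 comes from m + 2 <= 2 (m + 1). *)
move=> fs k; have [B B0 HB] := fs k; exists (B * 2 ^+ N).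
  by rewrite mulr_ge0 ?exprn_ge0.
move=> x m Px; rewrite iter_dif_shift.
apply: le_trans (_ : normc (iter k dif (f x) m.+1) * m.+2%:R ^+ (k + j) <= _).
  by rewrite ler_wpM2l ?normc_ge0 // lerXn2r ?nnegrE // ler_nat.
apply: le_trans (HB x m.+1 Px) _.
have -> : B * 2 ^+ N * w x * m.+1%:R ^+ N = B * w x * (2 * m.+1%:R) ^+ N.
  by rewrite exprMn; ring.
rewrite ler_wpM2l ?mulr_ge0 //.
by rewrite lerXn2r ?nnegrE ?mulr_ge0 // -natrM ler_nat; lia.
Qed.

Lemma osymb_coef (v : X -> R) (c : X -> R[i]) N j f :
  (forall x, P x -> normc (c x) <= v x) -> osymb P w N j f ->
  osymb P (fun x => v x * w x) N j (fun x m => c x * f x m).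
Proof.
move=> cv fs k; have [B B0 HB] := fs k; exists B => // x m Px.
rewrite iter_difZ normcM -mulrA [B * _]mulrCA -[leRHS]mulrA.
have c0 := normc_ge0 (c x).
apply: ler_pM => //; last 2 first.
- exact: cv.
- exact: HB.
by rewrite mulr_ge0 ?normc_ge0 ?exprn_ge0.
Qed.

Lemma osymbZ c N j f : osymb P w N j f ->
  osymb P w N j (fun x m => c * f x m).
Proof.
move=> fs k; have [B B0 HB] := fs k; exists (normc c * B).
  by rewrite mulr_ge0 ?normc_ge0.
move=> x m Px; rewrite iter_difZ normcM -!mulrA ler_wpM2l ?normc_ge0 //.
by rewrite mulrA; exact: HB.
Qed.

Lemma symb_ext f g : (forall x m, P x -> f x m = g x m) ->
  symb P w f -> symb P w g.
Proof. by move=> fg [N fs]; exists N; exact: osymb_ext fs. Qed.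

Lemma symbD f g : symb P w f -> symb P w g ->
  symb P w (fun x m => f x m + g x m).
Proof.
move=> [N fs] [N' gs]; exists (N + N')%N; apply: osymbD.
  exact: osymb_weaken (leq_addr _ _) (leqnn _) fs.
exact: osymb_weaken (leq_addl _ _) (leqnn _) gs.
Qed.

Lemma symbZ c f : symb P w f -> symb P w (fun x m => c * f x m).
Proof. by move=> [N fs]; exists N; exact: osymbZ. Qed.

Lemma symb_tame f x : P x -> symb P w f -> tame (f x).
Proof.
(* One difference beyond the order N leaves a bound O(1 / (m + 1)). *)
move=> Px [N fs]; exists N.+1 => e e0; have [B B0 HB] := fs N.+1.
have Bw : 0 <= B * w x by rewrite mulr_ge0.
exists (Num.bound (B * w x / e)) => m mb.
rewrite subr0; have m0 : 0 < m.+1%:R :> R by rewrite ltr0n.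
have := HB x m Px; rewrite addn0 exprS mulrA -subr_ge0 -mulrBl.
rewrite pmulr_lge0 ?exprn_gt0 // subr_ge0 -ler_pdivlMr // => le1.
apply: le_lt_trans le1 _; rewrite ltr_pdivrMr // [e * _]mulrC -ltr_pdivrMr //.
have /archi_boundP bound_gt : 0 <= B * w x / e by rewrite divr_ge0 // ltW.
by apply: lt_le_trans bound_gt _; rewrite ler_nat (leq_trans mb).
Qed.

End OneWeight.

Section TwoWeights.
Context {X : Type} (P : set X) (w w' : X -> R).
Hypotheses (w_ge0 : forall x, 0 <= w x) (w'_ge0 : forall x, 0 <= w' x).
Implicit Types f g : X -> nat -> R[i].

Lemma osymb_le N j f : (forall x, P x -> w x <= w' x) ->
  osymb P w N j f -> osymb P w' N j f.
Proof.
move=> ww fs k; have [B B0 HB] := fs k; exists B => // x m Px.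
apply: le_trans (HB x m Px) _; rewrite ler_wpM2r ?exprn_ge0 //.
by rewrite ler_wpM2l // ww.
Qed.

(** Discrete Leibniz rule: D(f g) = (D f) g + (E f) (D g) with E the shift. The induction on [k]
    needs [j] and [j'] free: the differenced factor has its own exponent raised by one, which
    accounts for the passage from k to k + 1. *)
Lemma osymbM N N' j j' f g : osymb P w N j f -> osymb P w' N' j' g ->
  osymb P (fun x => w x * w' x) (N + N') (j + j') (fun x m => f x m * g x m).
Proof.
move=> fs gs k; elim: k j j' f g fs gs => [|k IHk] j j' f g fs gs.
  have [B B0 HB] := fs 0%N; have [B' B'0 HB'] := gs 0%N.
  exists (B * B') => [|x m Px]; first exact: mulr_ge0.
  have := ler_pM _ _ (HB x m Px) (HB' x m Px).
  rewrite !mulr_ge0 ?normc_ge0 ?exprn_ge0 //= => /(_ isT isT) le1.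
  rewrite normcM !add0n !exprD [leLHS]mulrACA.
  by apply: le_trans le1 _; rewrite mulrACA [_ * w x * _]mulrACA.
have [B B0 HB] := IHk _ _ _ _ (osymb_dif fs) gs.
have [B' B'0 HB'] := IHk _ _ _ _ (osymb_shift w_ge0 fs) (osymb_dif gs).
exists (B + B') => [|x m Px]; first exact: addr_ge0.
rewrite iterSr.
have -> : dif (fun m => f x m * g x m) =
    (fun m => dif (f x) m * g x m + f x m.+1 * dif (g x) m).
  by apply/funext => n; rewrite /dif; ring.
rewrite iter_difD !mulrDl; apply: le_trans (lerD (HB x m Px) (HB' x m Px)).
have -> : (k + (j + j'.+1) = k.+1 + (j + j'))%N by lia.
have -> : (k + (j.+1 + j') = k.+1 + (j + j'))%N by lia.
by rewrite -mulrDl ler_wpM2r ?exprn_ge0 // normcD.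
Qed.

Lemma symb_le f : (forall x, P x -> w x <= w' x) -> symb P w f -> symb P w' f.
Proof. by move=> ww [N fs]; exists N; exact: osymb_le. Qed.

Lemma symbM f g : symb P w f -> symb P w' g ->
  symb P (fun x => w x * w' x) (fun x m => f x m * g x m).
Proof. by move=> [N fs] [N' gs]; exists (N + N')%N; exact: (osymbM fs gs). Qed.

Lemma symb_coef (c : X -> R[i]) f :
  (forall x, P x -> normc (c x) <= w' x) -> symb P w f ->
  symb P (fun x => w' x * w x) (fun x m => c x * f x m).
Proof. by move=> cw [N fs]; exists N; exact: osymb_coef. Qed.

End TwoWeights.

Lemma symb_comp (X Y : Type) (P : set X) (Q : set Y) w (f : X -> nat -> R[i])
    (u : Y -> X) : (forall y, Q y -> P (u y)) ->
  symb P w f -> symb Q (w \o u) (f \o u).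
Proof.
move=> QP [N fs]; exists N => k; have [B B0 HB] := fs k.
by exists B => // y m /QP; exact: HB.
Qed.

End Symbols.

(** * The summation equation for a fixed z <> 1 on the unit circle *)

Section AbelSummation.
Context {R : realType} (z : R[i]) (z_unit : normc z = 1) (z_neq1 : z != 1).

Section Existence.
Context {X : Type} (P : set X) (w : X -> R) (w_ge0 : forall x, 0 <= w x).
Implicit Types f g : X -> nat -> R[i].

(** Here the k-th differences of [f] are O(m^-(2 + q)) with q = k + j - N - 2, so the series and all
    its differenced forms converge absolutely. Summing a tail costs one power of m, hence [N.+1]. *)
Lemma abs_convergent_solution N j f : (N.+2 <= j)%N -> osymb P w N j f ->
  exists2 g, osymb P w N.+1 j g &
    forall x m, P x -> g x m = z * (f x m.+1 + g x m.+1).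
Proof.
move=> Nj fs.
pose S k x m n := \sum_(i < n) z ^+ i.+1 * iter k dif (f x) (m.+1 + i)%N.
have bnd k : exists2 B : R, 0 <= B & forall x m, P x -> exists p : nat -> R,
    [/\ forall n n', (n <= n')%N ->
          normc (S k x m n' - S k x m n) <= p n' - p n,
        p 0%N = 0 &
        forall n, p n * m.+1%:R ^+ (k + j) <= B * w x * m.+1%:R ^+ N.+1].
  have [B B0 HB] := fs k; exists B => // x m Px.
  have [q kj] : exists q, (k + j = N.+2 + q)%N by exists (k + j - N.+2)%N; lia.
  pose c := B * w x / m.+1%:R ^+ q.
  have c0 : 0 <= c by rewrite divr_ge0 ?mulr_ge0 ?exprn_ge0.
  (* A telescoping majorant: 1/(M (M + 1)) dominates 1/(M + 1)^2, and the other q powers are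
     estimated at the start m + 1 and put into [c]. *)
  pose p n : R := c * (m.+1%:R^-1 - (m.+1 + n)%:R^-1).
  exists p; split; last 2 first.
  - by rewrite /p addn0 subrr mulr0.
  - move=> n; rewrite kj /p.
    apply: le_trans (_ : c * m.+1%:R^-1 * m.+1%:R ^+ (N.+2 + q) <= _).
      rewrite ler_wpM2r ?exprn_ge0 // ler_wpM2l // gerDl oppr_le0.
      by rewrite invr_ge0.
    rewrite /c exprD exprS.
    have M0 : m.+1%:R != 0 :> R by [].
    have Mq0 : m.+1%:R ^+ q != 0 :> R by rewrite expf_neq0.
    move: (m.+1%:R ^+ q) Mq0 => Mq Mq0; move: (m.+1%:R ^+ N.+1) => MN.
    move: (m.+1%:R) M0 => M M0.
    by rewrite le_eqVlt; apply/orP; left; apply/eqP; field; apply/andP.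
  have term n : normc (z ^+ n.+1 * iter k dif (f x) (m.+1 + n)%N) <= p n.+1 - p n.
    rewrite normcM normcX z_unit expr1n mul1r.
    set M : R := (m.+1 + n)%:R; set D := normc _.
    have m1 : 1 <= m.+1%:R :> R by rewrite ler1n.
    have mM : m.+1%:R <= M by rewrite ler_nat leq_addr.
    have MS : (m.+1 + n.+1)%:R = M + 1 :> R by rewrite addnS -natr1.
    have MS' : (m.+1 + n).+1%:R = M + 1 :> R by rewrite -natr1.
    have := HB x (m.+1 + n)%N Px; rewrite -/D kj MS' => HD.
    have D_le : D * ((M + 1) ^+ 2 * (M + 1) ^+ q) <= B * w x.
      rewrite -(ler_pM2r (_ : 0 < (M + 1) ^+ N)) ?exprn_gt0; [|lra..].
      by apply: le_trans HD; rewrite -mulrA -!exprD [(_ + N)%N]addnC addnA addn2.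
    have p_diff : p n.+1 - p n = c / (M * (M + 1)).
      by rewrite /p MS -/M; field; apply/andP; split; lra.
    rewrite p_diff ler_pdivlMr; last by rewrite mulr_gt0; lra.
    rewrite /c ler_pdivlMr ?exprn_gt0 //; apply: le_trans D_le.
    rewrite -mulrA ler_wpM2l ?normc_ge0 // ler_pM ?exprn_ge0 ?mulr_ge0 //; [lra..| |].
      by rewrite expr2 ler_wpM2r; lra.
    by rewrite lerXn2r ?nnegrE; lra.
  move=> n n' /subnKC <-; elim: (n' - n)%N => [|d IHd].
    by rewrite addn0 !subrr (@normc0 R).
  rewrite addnS /S big_ord_recr -/(S k x m (n + d)%N) /=.
  rewrite addrAC; apply: le_trans (normcD _ _) _.
  by have := term (n + d)%N; rewrite /S in IHd *; lra.
(* For [x] in [P] the limit exists, so the default 0 does not enter there. The sums [S k] then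
   converge to the k-th difference of [g], which carries every bound over to [g]. *)
pose g x m := xget 0 [set l | clim (S 0%N x m) l].
have gk k x m : P x -> clim (S k x m) (iter k dif (g x) m).
  move=> Px; elim: k m => [|k IHk] m.
    have [B B0 /(_ x m Px)[p [Sp p0 pB]]] := bnd 0%N.
    have [|l Sl] := @clim_cauchy _ _ p (B * w x * m.+1%:R ^+ N.+1) Sp.
      move=> n; apply: le_trans (pB n); rewrite ler_peMr ?exprn_ege1 ?ler1n //.
      by have := Sp _ _ (leq0n n); rewrite p0 subr0; apply: le_trans (normc_ge0 _).
      by rewrite /= /g; case: xgetP => [y _|/(_ l)].
  rewrite iterS {1}/dif; apply: clim_ext (climB (IHk m.+1) (IHk m)) => n.
  rewrite /S -sumrB; apply: eq_bigr => i _.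
  by rewrite iterS /dif addSn; ring.
exists g.
  move=> k; have [B B0 HB] := bnd k; exists B => // x m Px.
  have [p [Sp p0 pB]] := HB x m Px.
  rewrite -ler_pdivlMr ?exprn_gt0 //.
  apply: clim_normc_le (gk k x m Px) _ => n.
  rewrite ler_pdivlMr ?exprn_gt0 //; apply: le_trans (pB n).
  rewrite ler_wpM2r ?exprn_ge0 //.
  by have := Sp _ _ (leq0n n); rewrite p0 /S big_ord0 !subr0.
move=> x m Px; apply: clim_unique (clim_shift (gk 0%N x m Px)) _.
rewrite mulrDr.
apply: clim_ext (climD (clim_cst _) (climZ z (gk 0%N x m.+1 Px))) => n.
rewrite /S big_ord_recl addn0 expr1 mulr_sumr; congr (_ + _).
by apply: eq_bigr => i _; rewrite /= mulrA -exprS /bump /= addnS addSn.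
Qed.

(* With [E] the shift and [D = E - 1], the equation is [(1 - z E) g = z E f],
   and [1 - z E = (1 - z) - z D]: solving it for [D f], whose order is smaller
   by one, solves it for [f]. *)
Lemma osymb_solution N j f : osymb P w N j f ->
  exists2 g, osymb P w N.+1 j g &
    forall x m, P x -> g x m = z * (f x m.+1 + g x m.+1).
Proof.
have [d] : exists d, (N.+2 <= j + d)%N by exists N.+2; lia.
elim: d j f => [|d IHd] j f; first by rewrite addn0; exact: abs_convergent_solution.
rewrite addnS -addSn => /IHd{}IHd fs.
have [g gs gE] := IHd _ (osymb_dif fs).
pose q := z / (1 - z); have q_z : q * (1 - z) = z.
  by rewrite divfK // subr_eq0 eq_sym.
exists (fun x m => q * (f x m.+1 + g x m)).
  apply: osymbZ; apply: osymbD.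
    by apply: osymb_weaken (osymb_shift w_ge0 fs).
  exact: osymb_weaken gs.
move=> x m Px; rewrite (gE x m Px) /dif.
set F1 := f x m.+1; set F2 := f x m.+2; set G := g x m.+1.
apply/subr0_eq; transitivity (F1 * (q * (1 - z) - z)); first by ring.
by rewrite q_z subrr mulr0.
Qed.

End Existence.

(** Choosing the solution by its characterisation makes it depend on the single sequence [f],
    whatever family or weight proves existence. Without a tame solution the value is the zero
    sequence. *)
Definition abel_sum f : nat -> R[i] := xget (cst 0)
  [set g | tame g /\ forall m, g m = z * (f m.+1 + g m.+1)].

Lemma abel_sum_eq f g : tame g -> (forall m, g m = z * (f m.+1 + g m.+1)) ->
  abel_sum f = g.
Proof.
move=> g_tame gE; rewrite /abel_sum; case: xgetP => [h _ [h_tame hE]|]; last first.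
  by move=> /(_ g (conj g_tame gE)).
apply/funext => m; apply/eqP; rewrite -subr_eq0; apply/eqP.
apply: (tame_geometric z_unit z_neq1 (tameB h_tame g_tame)) => n.
by rewrite hE gE; ring.
Qed.

Section Families.
Context {X : Type} (P : set X) (w : X -> R) (w_ge0 : forall x, 0 <= w x).
Implicit Types f g : X -> nat -> R[i].

Lemma abel_sumP f x : P x -> symb P w f -> tame (abel_sum (f x)) /\
  forall m, abel_sum (f x) m = z * (f x m.+1 + abel_sum (f x) m.+1).
Proof.
move=> Px [N fs]; have [g gs gE] := osymb_solution w_ge0 fs.
have g_tame : tame (g x) by apply: symb_tame Px _ => //; exists N.+1.
by rewrite (abel_sum_eq g_tame) => [|m]; [split=> // m|]; exact: gE.
Qed.

(** By uniqueness the family built in [osymb_solution] is pointwise [abel_sum]. Keeping the same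
    weight [w] is what preserves smallness of first and second order in h. *)
Lemma symb_abel_sum f : symb P w f -> symb P w (fun x => abel_sum (f x)).
Proof.
move=> [N fs]; have [g gs gE] := osymb_solution w_ge0 fs.
exists N.+1; apply: osymb_ext (gs) => x m Px.
have g_tame : tame (g x) by apply: symb_tame Px _ => //; exists N.+1.
by rewrite (abel_sum_eq g_tame) // => n; rewrite gE.
Qed.

End Families.

Lemma abel_sum_linear (X Y : Type) (P : set X) (Q : set Y) w v
    (f : X -> nat -> R[i]) (g : Y -> nat -> R[i]) x y c :
  (forall x, 0 <= w x) -> (forall y, 0 <= v y) -> P x -> Q y ->
  symb P w f -> symb Q v g ->
  abel_sum (fun m => c * f x m + g y m) =
  (fun m => c * abel_sum (f x) m + abel_sum (g y) m).
Proof.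
move=> w0 v0 Px Qy fs gs.
have [ft fE] := abel_sumP w0 Px fs; have [gt gE] := abel_sumP v0 Qy gs.
apply: abel_sum_eq => [|m]; last by rewrite fE gE; ring.
have -> : (fun m => c * abel_sum (f x) m + abel_sum (g y) m) =
    (fun m => abel_sum (g y) m - - c * abel_sum (f x) m).
  by apply/funext => m; ring.
by apply: tameB => //; exact: tameZ.
Qed.

End AbelSummation.

(** * Powers are symbols *)

Section ComplexExponentialTheory.
Context {R : realType}.
Implicit Types z w : R[i].

Lemma cexpD z w : cexp (z + w) = cexp z * cexp w.
Proof.
case: z w => a b [c d]; rewrite /cexp /= expRD sinD cosD.
apply/eqP; rewrite eq_complex /=; apply/andP; split; apply/eqP; ring.
Qed.

Lemma cexp0 : cexp 0 = 1 :> R[i].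
Proof. by rewrite /cexp /= expR0 sin0 cos0 mul1r. Qed.

Lemma normc_cexp z : normc (cexp z) = expR (complex.Re z).
Proof.
rewrite normcM normc_real ger0_norm ?expR_ge0 //=.
by rewrite cos2Dsin2 sqrtr1 mulr1.
Qed.

Lemma cexp_neq0 z : cexp z != 0.
Proof.
apply/eqP => /(congr1 (@normc R))/eqP.
by rewrite normc_cexp (@normc0 R) expR_eq0.
Qed.

Lemma cexpN z : cexp (- z) = (cexp z)^-1.
Proof.
apply: (mulfI (cexp_neq0 z)).
by rewrite -cexpD subrr cexp0 divff // cexp_neq0.
Qed.

End ComplexExponentialTheory.

(** * Calculus for complex-valued functions of a real variable *)

Section RealVariable.
Context {R : realType}.
Implicit Types (g : R -> R[i]) (y : R) (d : R[i]).

Definition cder g y d :=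
  is_derive y 1 (fun t => complex.Re (g t) : R) (complex.Re d) /\
  is_derive y 1 (fun t => complex.Im (g t) : R) (complex.Im d).

Lemma cder_eq g y d d' : cder g y d -> d = d' -> cder g y d'.
Proof. by move=> ? <-. Qed.

Lemma cderD f g y d d' : cder f y d -> cder g y d' ->
  cder (fun t => f t + g t) y (d + d').
Proof.
move=> [fr fi] [gr gi]; split; rewrite ?Re_add ?Im_add.
  by rewrite (_ : (fun t => _) =
    (fun t => complex.Re (f t) : R) + (fun t => complex.Re (g t)))
    ; [exact: is_deriveD|apply/funext => t; rewrite Re_add].
by rewrite (_ : (fun t => _) =
    (fun t => complex.Im (f t) : R) + (fun t => complex.Im (g t)))
    ; [exact: is_deriveD|apply/funext => t; rewrite Im_add].
Qed.

Lemma cder_cst y d : cder (fun=> d) y 0.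
Proof. by split; apply: is_derive_cst. Qed.

Lemma cderM f g y d d' : cder f y d -> cder g y d' ->
  cder (fun t => f t * g t) y (f y * d' + d * g y).
Proof.
move=> [fr fi] [gr gi]; split.
  rewrite (_ : (fun t => _) =
    (fun t => complex.Re (f t) : R) * (fun t => complex.Re (g t)) -
    (fun t => complex.Im (f t) : R) * (fun t => complex.Im (g t))).
    apply: is_derive_eq; rewrite Re_add !Re_mul /GRing.scale /=; ring.
  by apply/funext => t; rewrite Re_mul.
rewrite (_ : (fun t => _) =
    (fun t => complex.Re (f t) : R) * (fun t => complex.Im (g t)) +
    (fun t => complex.Im (f t) : R) * (fun t => complex.Re (g t))).
  apply: is_derive_eq; rewrite Im_add !Im_mul /GRing.scale /=; ring.
by apply/funext => t; rewrite Im_mul.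
Qed.

Lemma cderZ c f y d : cder f y d -> cder (fun t => c * f t) y (c * d).
Proof.
by move=> fd; apply: cder_eq (cderM (cder_cst _ c) fd) _; rewrite mul0r addr0.
Qed.

Lemma cderB f g y d d' : cder f y d -> cder g y d' ->
  cder (fun t => f t - g t) y (d - d').
Proof.
move=> fd gd; rewrite (_ : (fun t => _) = fun t => f t + -1 * g t).
  by rewrite -[- d']mulN1r; apply: cderD => //; exact: cderZ.
by apply/funext => t; rewrite mulN1r.
Qed.

Lemma cder_real (g : R -> R) y (d : R) : is_derive y 1 g d ->
  cder (fun t => (g t)%:C%C) y d%:C%C.
Proof. by move=> gd; split => //=; apply: is_derive_cst. Qed.

Lemma cder_cexp g y d : cder g y d ->
  cder (fun t => cexp (g t)) y (d * cexp (g y)).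
Proof.
move=> [gr gi].
have er : is_derive y 1 (fun t => expR (complex.Re (g t)) : R)
    (complex.Re d * expR (complex.Re (g y))).
  by have := is_derive1_comp (is_derive_expR _) gr; rewrite mulrC.
have ec : is_derive y 1 (fun t => cos (complex.Im (g t)) : R)
    (complex.Im d * - sin (complex.Im (g y))).
  by have := is_derive1_comp (is_derive_cos _) gi; rewrite mulrC.
have es : is_derive y 1 (fun t => sin (complex.Im (g t)) : R)
    (complex.Im d * cos (complex.Im (g y))).
  by have := is_derive1_comp (is_derive_sin _) gi; rewrite mulrC.
have h : cder (fun t => (cos (complex.Im (g t)) +i* sin (complex.Im (g t)))%C) y
  (complex.Im d * - sin (complex.Im (g y)) +i*
   (complex.Im d * cos (complex.Im (g y))))%C.
  by split.
apply: cder_eq (cderM (cder_real er) h) _.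
rewrite /cexp; case: d {gr gi er ec es h} => a b /=.
apply/eqP; rewrite eq_complex /=; apply/andP; split; apply/eqP; ring.
Qed.

Lemma cder_shift g y d : cder g (y + 1) d -> cder (fun t => g (t + 1)) y d.
Proof.
have shift (f : R -> R) a : is_derive (y + 1) 1 f a ->
    is_derive y 1 (fun t => f (t + 1)) a.
  move=> fd; have s : is_derive y 1 (fun t : R => t + 1) 1 by exact: is_derive_shift.
  by have := @is_derive1_comp _ f (fun t => t + 1) _ _ _ fd s; rewrite mulr1.
by move=> [gr gi]; split; apply: shift.
Qed.

(** The mean value theorem is applied to the real and imaginary parts separately, which gives twice
    the real bound. *)
Lemma cder_le g (g' : R -> R[i]) (a b B : R) : a <= b ->
  (forall t, a <= t <= b -> cder g t (g' t)) ->
  (forall t, a <= t <= b -> normc (g' t) <= B) ->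
  normc (g b - g a) <= 2 * B * (b - a).
Proof.
move=> ab gg' gB.
have ba : 0 <= b - a by rewrite subr_ge0.
have part (p : R[i] -> R) : (forall z, `|p z| <= normc z) ->
    (forall t, a <= t <= b -> is_derive t 1 (fun t => p (g t)) (p (g' t))) ->
    `|p (g b) - p (g a)| <= B * (b - a).
  move=> p_le pd.
  have [||c] := @MVT_segment _ (fun t => p (g t)) (fun t => p (g' t)) a b ab.
  - by move=> x; rewrite in_itv /= => /andP[/ltW ax /ltW xb]; apply: pd; rewrite ax.
  - apply: derivable_within_continuous => x; rewrite in_itv /= => xab.
    by have [] := pd _ xab.
  rewrite in_itv /= => cab ->; rewrite normrM (ger0_norm ba) //.
  by rewrite ler_wpM2r // (le_trans (p_le _)) // gB.
have h1 := part _ (@abs_Re_le R) (fun t tab => (gg' t tab).1).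
have h2 := part _ (@abs_Im_le R) (fun t tab => (gg' t tab).2).
apply: le_trans (normc_le_ReIm _) _; rewrite Re_add Im_add Re_opp Im_opp.
by lra.
Qed.

End RealVariable.

Section TruncatedExponential.
Context {R : realType}.
Implicit Types (u : R[i]) (I : nat).

(* [cexp] minus the first [I] terms of its Taylor expansion, for [I <= 2]. *)
Definition exp_rem I u : R[i] :=
  match I with 0 => cexp u | 1 => cexp u - 1 | _ => cexp u - 1 - u end.

(** For I = 0 the index [I.-1] is again 0, as it must be, [cexp] being its own derivative. *)
Lemma cder_exp_rem I g y d : (I <= 2)%N -> cder g y d ->
  cder (fun t => exp_rem I (g t)) y (d * exp_rem I.-1 (g y)).
Proof.
move=> I2 gd; have ed := cder_cexp gd.
have ed1 : cder (fun t => cexp (g t) - 1) y (d * cexp (g y)).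
  by apply: cder_eq (cderB ed (cder_cst _ _)) (subr0 _).
case: I I2 => [|[|[|//]]] _ //=.
by apply: cder_eq (cderB ed1 gd) _; ring.
Qed.

(** Mean value inequality along the segment t u, 0 <= t <= 1: passing from one remainder to the next
    multiplies the bound by 2 |u|, and two passages give the constant 4. *)
Lemma exp_rem_le I u : (I <= 2)%N ->
  normc (exp_rem I u) <= 4 * normc u ^+ I * expR (normc u).
Proof.
have u0 := normc_ge0 u; have e0 := expR_ge0 (normc u).
have Re_le (t : R) : 0 <= t <= 1 -> complex.Re (u * t%:C%C) <= normc u.
  move=> /andP[t0 t1]; apply: le_trans (ler_norm _) _.
  apply: le_trans (abs_Re_le _) _.
  by rewrite normcM normc_real ger0_norm // ler_piMr.
have E0 (t : R) : 0 <= t <= 1 -> normc (exp_rem 0 (u * t%:C%C)) <= expR (normc u).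
  by move=> /Re_le; rewrite normc_cexp ler_expR.
have step J B : (J < 2)%N -> exp_rem J.+1 0 = 0 ->
    (forall t : R, 0 <= t <= 1 -> normc (exp_rem J (u * t%:C%C)) <= B) ->
    forall t : R, 0 <= t <= 1 -> normc (exp_rem J.+1 (u * t%:C%C)) <= 2 * (normc u * B).
  move=> J2 E00 EB t /andP[t0 t1].
  have B0 : 0 <= B.
    by have := EB 0; rewrite lexx ler01 => /(_ isT); apply: le_trans (normc_ge0 _).
  have ud (s : R) : cder (fun s : R => u * s%:C%C) s u.
    apply: cder_eq (cderZ u (cder_real (is_derive_id s 1))) _.
    by rewrite rmorph1 mulr1.
  have := @cder_le _ (fun s => exp_rem J.+1 (u * s%:C%C))
    (fun s => u * exp_rem J (u * s%:C%C)) 0 t (normc u * B) t0.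
  rewrite mulr0 E00 !subr0 => le_t.
  apply: le_trans (le_t _ _) _ => [s _|s /andP[s0 st]|].
  - exact: cder_exp_rem.
  - rewrite normcM ler_wpM2l //; apply: EB; rewrite s0 /=; exact: le_trans t1.
  - by rewrite ler_piMr ?mulr_ge0.
have E1 := step 0%N _ isT (_ : cexp 0 - 1 = 0) E0.
rewrite cexp0 subrr in E1; move: E1 => /(_ erefl) E1.
have E2 := step 1%N _ isT (_ : cexp 0 - 1 - 0 = 0) E1.
rewrite cexp0 subrr subr0 in E2; move: E2 => /(_ erefl) E2.
have h01 : 0 <= (1 : R) <= 1 by rewrite ler01 /=.
move: (E0 _ h01) (E1 _ h01) (E2 _ h01); rewrite rmorph1 mulr1.
case: I => [|[|[|//]]] h0 h1 h2 _.
- by apply: le_trans h0 _; rewrite expr0; lra.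
- apply: le_trans h1 _; rewrite expr1 mulrA ler_wpM2r //; lra.
- by apply: le_trans h2 _; rewrite expr2; lra.
Qed.

End TruncatedExponential.

Section PowerSymbols.
Context {R : realType}.
Implicit Types (s h : R[i]) (y : R) (I : nat).

(** This is y^-(s + h) minus the first [I] terms of its expansion in h at 0. *)
Definition pow_rem I s h y : R[i] :=
  cexp (- (s * (ln y)%:C%C)) * exp_rem I (- (h * (ln y)%:C%C)).

(** Differentiation in y produces a factor 1/y, absorbed as s + 1. The second term has a remainder
    of lower order but a factor h, so no smallness in h is lost. *)
Lemma cder_pow_rem I s h y : (I <= 2)%N -> 0 < y ->
  cder (pow_rem I s h) y (- s * pow_rem I (s + 1) h y +
                          - h * pow_rem I.-1 (s + 1) h y).
Proof.
move=> I2 y0; have lnd := cder_real (is_derive1_ln y0).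
have lnZ c : cder (fun y => - (c * (ln y)%:C%C)) y (- c * (y^-1)%:C%C).
  have -> : (fun y => - (c * (ln y)%:C%C)) = (fun y => - c * (ln y)%:C%C).
    by apply/funext => t; rewrite mulNr.
  exact: cderZ.
apply: cder_eq (cderM (cder_cexp (lnZ s)) (cder_exp_rem I2 (lnZ h))) _.
have yV : (y^-1)%:C%C = cexp (- (ln y)%:C%C).
  rewrite /cexp /= oppr0 sin0 cos0 expRN lnK ?posrE //.
  by apply/eqP; rewrite eq_complex /= !mulr0 mulr1 !mul0r subr0 addr0 !eqxx.
rewrite /pow_rem [(s + 1) * _]mulrDl mul1r opprD cexpD -yV.
ring.
Qed.

Definition rdif (g : R -> R[i]) : R -> R[i] := fun y => g (y + 1) - g y.

Lemma iter_rdif k g (a : R) m :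
  iter k rdif g (m.+1%:R + a) = iter k dif (fun m => g (m.+1%:R + a)) m.
Proof.
elim: k m => //= k IHk m; rewrite /rdif /dif -!IHk -addrA [a + 1]addrC addrA.
by rewrite natr1.
Qed.

Lemma iter_rdif_lin k f g c d y : iter k rdif (fun y => c * f y + d * g y) y =
  c * iter k rdif f y + d * iter k rdif g y.
Proof. by elim: k y => //= k IHk y; rewrite /rdif !IHk; ring. Qed.

Lemma cder_iter_rdif k g g' : (forall y, 0 < y -> cder g y (g' y)) ->
  forall y, 0 < y -> cder (iter k rdif g) y (iter k rdif g' y).
Proof.
move=> gg'; elim: k => [//|k IHk] y y0; rewrite iterS.
apply: cderB (IHk _ y0); apply: cder_shift; apply: IHk.
by rewrite addr_gt0.
Qed.

(** The three extra powers of y: two cover (ln y)^I for I <= 2, and one covers exp(|h| ln y). *)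
Lemma pow_rem_bound I s N0 j h y : (I <= 2)%N -> `|complex.Re s| <= N0%:R ->
  normc h <= 1 -> 1 <= y ->
  normc (pow_rem I (s + j%:R) h y) * y ^+ j <= 4 * normc h ^+ I * y ^+ (N0 + 3).
Proof.
move=> I2 sN h1 y1; have y0 : 0 < y by lra.
have l0 := ln_ge0 y1; have ly := ltW (ln_sublinear y0).
have yE n : expR (n%:R * ln y) = y ^+ n by rewrite expRM_natl lnK.
have h0 := normc_ge0 h.
rewrite normcM normc_cexp mulrAC.
have Re_s : complex.Re (- ((s + j%:R) * (ln y)%:C%C)) =
    - complex.Re s * ln y - j%:R * ln y.
  have -> : j%:R = (j%:R : R)%:C%C :> R[i] by rewrite rmorph_nat.
  by case: s {sN} => a b /=; ring.
rewrite Re_s expRB yE divfK ?expf_neq0 ?gt_eqF //.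
have le1 : expR (- complex.Re s * ln y) <= y ^+ N0.
  rewrite -yE ler_expR ler_wpM2r //; apply: le_trans sN.
  by rewrite -normrN ler_norm.
have hl : normc (- (h * (ln y)%:C%C)) = normc h * ln y.
  by rewrite normcN normcM normc_real ger0_norm.
have le2 : normc (exp_rem I (- (h * (ln y)%:C%C))) <= 4 * normc h ^+ I * y ^+ 3.
  apply: le_trans (exp_rem_le _ I2) _; rewrite hl exprMn.
  rewrite mulrA -mulrA [y ^+ 3](_ : _ = y ^+ 2 * y); last by rewrite exprSr.
  rewrite ler_wpM2l ?mulr_ge0 ?exprn_ge0 // ler_pM ?exprn_ge0 ?expR_ge0 //.
    apply: le_trans (_ : y ^+ I <= _); last by rewrite ler_weXn2l.
    by rewrite lerXn2r ?nnegrE // ltW.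
  apply: le_trans (_ : expR (ln y) <= _); last by rewrite lnK.
  by rewrite ler_expR ler_piMl.
rewrite exprD mulrCA; apply: ler_pM => //; rewrite ?expR_ge0 //.
exact: normc_ge0.
Qed.

(** A (k + 1)-st difference is the increment over [y, y + 1] of a k-th difference, hence bounded by
    k-th differences of the derivative. By [cder_pow_rem] these involve s + j + 1 and both [I] and
    [I.-1], so [I] and [j] vary in the induction. *)
Lemma rdif_pow_rem_bound k I s N0 j : (I <= 2)%N -> `|complex.Re s| <= N0%:R ->
  exists2 B : R, 0 <= B & forall h y, normc h <= 1 -> 1 <= y ->
  normc (iter k rdif (pow_rem I (s + j%:R) h) y) * y ^+ (k + j) <=
    B * normc h ^+ I * y ^+ (N0 + 3).
Proof.
move=> I2 sN; elim: k I I2 j => [|k IHk] I I2 j.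
  by exists 4 => // h y h1 y1; exact: pow_rem_bound.
have [B B0 HB] := IHk I I2 j.+1.
have [B' B'0 HB'] := IHk I.-1 (leq_trans (leq_pred _) I2) j.+1.
pose n := normc (s + j%:R); have n0 : 0 <= n by exact: normc_ge0.
(* The first 2 is that of [cder_le]; the power of 2 comes from t <= y + 1 <= 2 y. *)
exists (2 * (n * B + B') * 2 ^+ (N0 + 3)) => [|h y h1 y1].
  by rewrite !mulr_ge0 ?addr_ge0 ?exprn_ge0 ?mulr_ge0.
have h0 := normc_ge0 h; have y0 : 0 < y by lra.
pose f t := - (s + j%:R) * pow_rem I (s + j.+1%:R) h t +
            - h * pow_rem I.-1 (s + j.+1%:R) h t.
have fd t : 0 < t -> cder (pow_rem I (s + j%:R) h) t (f t).
  move=> t0; apply: cder_eq (cder_pow_rem (s + j%:R) h I2 t0) _.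
  by rewrite /f -addrA natr1.
have hI : normc h * normc h ^+ I.-1 <= normc h ^+ I.
  case: (I) => [|I']; first by rewrite expr0 mulr1.
  by rewrite -exprS.
have fk t : y <= t <= y + 1 -> normc (iter k rdif f t) <=
    (n * B + B') * 2 ^+ (N0 + 3) * normc h ^+ I * y ^+ (N0 + 3) / y ^+ (k.+1 + j).
  move=> /andP[yt t1]; have t1' : 1 <= t by lra.
  rewrite iter_rdif_lin; apply: le_trans (normcD _ _) _.
  rewrite !normcM !normcN -/n ler_pdivlMr ?exprn_gt0 //.
  have ty : y ^+ (k.+1 + j) <= t ^+ (k + j.+1).
    by rewrite addSnnS lerXn2r ?nnegrE //; lra.
  have tN : t ^+ (N0 + 3) <= 2 ^+ (N0 + 3) * y ^+ (N0 + 3).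
    by rewrite -exprMn lerXn2r ?nnegrE; lra.
  have := HB h t h1 t1'; have := HB' h t h1 t1'.
  set D := normc (iter k rdif (pow_rem I.-1 _ _) t).
  set D' := normc (iter k rdif (pow_rem I _ _) t).
  move=> HD HD'.
  apply: le_trans (_ : (n * D' + normc h * D) * t ^+ (k + j.+1) <= _).
    by rewrite ler_wpM2l // addr_ge0 ?mulr_ge0 ?normc_ge0.
  rewrite mulrDl -!mulrA.
  have a1 := ler_wpM2l n0 HD'; have a2 := ler_wpM2l h0 HD.
  apply: le_trans (lerD a1 a2) _.
  have a3 : normc h * (B' * normc h ^+ I.-1 * t ^+ (N0 + 3)) <=
      B' * normc h ^+ I * t ^+ (N0 + 3).
    rewrite [leLHS](_ : _ = B' * (normc h * normc h ^+ I.-1) * t ^+ (N0 + 3));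
      last by ring.
    apply: ler_wpM2r; first by rewrite exprn_ge0 //; lra.
    exact: ler_wpM2l.
  apply: le_trans (lerD (lexx _) a3) _.
  have a4 : (n * B + B') * normc h ^+ I * t ^+ (N0 + 3) <=
      (n * B + B') * normc h ^+ I * (2 ^+ (N0 + 3) * y ^+ (N0 + 3)).
    by rewrite ler_wpM2l // mulr_ge0 ?addr_ge0 ?mulr_ge0 ?exprn_ge0.
  by move: a4; rewrite !mulrDl !mulrA; lra.
have := @cder_le _ (iter k rdif (pow_rem I (s + j%:R) h)) (iter k rdif f) y (y + 1) _
  (_ : y <= y + 1) _ fk.
rewrite lerDl ler01 => /(_ isT) le_k.
rewrite -ler_pdivlMr ?exprn_gt0 // iterS {1}/rdif.
apply: le_trans (le_k _) _.
  by move=> t /andP[yt _]; apply: cder_iter_rdif => //; lra.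
by rewrite [y + 1]addrC addrK mulr1 !mulrA.
Qed.

Lemma symb_pow_rem I s (a : R) : (I <= 2)%N -> 0 <= a ->
  symb [set h | normc h <= 1] (fun h => normc h ^+ I)
    (fun h m => pow_rem I s h (m.+1%:R + a)).
Proof.
move=> I2 a0; pose N0 := Num.bound `|complex.Re s|; exists (N0 + 3)%N => k.
have sN : `|complex.Re s| <= N0%:R by apply/ltW/archi_boundP.
have [B B0 HB] := @rdif_pow_rem_bound k I s N0 0 I2 sN.
pose c : R := 1 + a; exists (B * c ^+ (N0 + 3)) => [|h m /= h1].
  by rewrite mulr_ge0 ?exprn_ge0 //; rewrite /c; lra.
have m1 : 1 <= m.+1%:R :> R by rewrite ler1n.
have y1 : 1 <= m.+1%:R + a by lra.
have := HB h _ h1 y1; rewrite addr0 iter_rdif => Hk.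
have h0 := normc_ge0 h.
apply: le_trans (_ : B * normc h ^+ I * (m.+1%:R + a) ^+ (N0 + 3) <= _).
  apply: le_trans Hk; rewrite ler_wpM2l ?normc_ge0 // lerXn2r ?nnegrE //; lra.
rewrite [leRHS](_ : _ = B * normc h ^+ I * (c * m.+1%:R) ^+ (N0 + 3)); last first.
  by rewrite exprMn; ring.
rewrite ler_wpM2l ?mulr_ge0 ?exprn_ge0 // lerXn2r ?nnegrE ?mulr_ge0 //; rewrite /c; nra.
Qed.

End PowerSymbols.

(** * Holomorphy *)

Lemma differentiable_littleo (K : numFieldType) (V W : normedModType K)
    (f : V -> W) (L : {linear V -> W}) x : continuous L ->
  (forall e : K, 0 < e ->
    \forall h \near 0, `|f (x + h) - f x - L h| <= e * `|h|) ->
  differentiable f x.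
Proof.
move=> Lc fL; have o_L : f \o shift x = cst (f x) + L +o_ 0 id.
  apply/eqaddoP => e /fL; apply: filterS => h.
  by rewrite [x + h]addrC -addrA -opprD.
by apply/diff_locallyP; rewrite (diff_unique Lc o_L).
Qed.

Section RowNorm.
Context {R : realType} {n : nat}.
Implicit Types h : 'rV[R[i]]_n.

(* The norm of the library takes its values in [R[i]]. *)
Definition rnorm h : R := complex.Re `|h|.

Lemma normr_rnorm h : `|h| = (rnorm h)%:C%C.
Proof. by rewrite /rnorm RRe_real // ger0_real. Qed.

Lemma rnorm_ge0 h : 0 <= rnorm h.
Proof. by rewrite -ler0c -normr_rnorm. Qed.

Lemma normc_le_rnorm h i : normc (h ord0 i) <= rnorm h.
Proof.
rewrite -lecR -normr_rnorm -normr_normc [leRHS]mx_normE.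
rewrite -[leLHS]nngE num_le.
exact: (le_bigmax _ (fun k => `|h k.1 k.2|%:nng) (ord0, i)).
Qed.

Lemma differentiable_quadratic (f D : 'rV[R[i]]_n -> R[i]) s0 (B B' : R) :
  (forall c h h', D (c *: h + h') = c * D h + D h') ->
  (forall h, normc (D h) <= B' * rnorm h) ->
  (forall h, rnorm h <= 1 ->
    normc (f (s0 + h) - f s0 - D h) <= B * rnorm h ^+ 2) ->
  differentiable f s0.
Proof.
move=> Dlin D_le f_le.
pose L : {linear 'rV[R[i]]_n -> R[i]} :=
  HB.pack D (GRing.isLinear.Build R[i] 'rV[R[i]]_n R[i] _ D Dlin).
have Lc : continuous L.
  apply/linear_bounded_continuous; apply/linear_boundedP.
  exists (`|B'|)%:C%C; split; first by rewrite complex_real.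
  move=> M BM h; rewrite normr_normc normr_rnorm.
  apply: le_trans (_ : `|B'|%:C%C * (rnorm h)%:C%C <= _).
    rewrite -rmorphM lecR; apply: le_trans (D_le h) _.
    by rewrite ler_wpM2r ?rnorm_ge0 ?ler_norm.
  by rewrite ler_wpM2r ?ler0c ?rnorm_ge0 // ltW.
apply: (@differentiable_littleo R[i] _ _ _ L) => // e e0.
  have e0' : 0 < complex.Re e by move: e0; rewrite ltcE => /andP[].
  have eE : e = (complex.Re e)%:C%C by rewrite RRe_real // gtr0_real.
  pose d := Num.min 1 (complex.Re e / (`|B| + 1)).
  have B0 : 0 < `|B| + 1 by rewrite ltr_wpDl.
  have d0 : 0 < d by rewrite lt_min ltr01 divr_gt0.
  apply/nbhs_norm0P; exists d%:C%C; first by rewrite /= ltcR.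
  move=> h /=; rewrite normr_rnorm ltcR lt_min => /andP[/ltW h1 hd].
  rewrite normr_normc eE -rmorphM lecR /=.
  apply: le_trans (f_le h h1) _; rewrite expr2 mulrA ler_wpM2r ?rnorm_ge0 //.
  move: hd; rewrite ltr_pdivlMr // => hd.
  have := rnorm_ge0 h; have := ler_norm B; nra.
Qed.

End RowNorm.

Section TaylorFamilies.
Context {R : realType} {n : nat}.
Local Notation V := 'rV[R[i]]_n.
Implicit Types (f g : V -> nat -> R[i]) (h : V).

Definition unit_ball : set V := [set h | rnorm h <= 1].

(** [D] lives on the whole space because it becomes the differential. Only the remainder is confined
    to the unit ball, where higher powers of |h| are absorbed by lower ones. *)
Definition taylor f := exists (a : nat -> R[i]) (D rho : V -> nat -> R[i]),
  [/\ forall h m, rnorm h <= 1 -> f h m = a m + D h m + rho h m,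
      forall c h h' m, D (c *: h + h') m = c * D h m + D h' m,
      symb setT (fun _ : V => 1) (fun _ => a),
      symb setT (@rnorm R n) D &
      symb unit_ball (fun h => rnorm h ^+ 2) rho].

Lemma symb_restrict (X : Type) (P Q : set X) w (f : X -> nat -> R[i]) :
  Q `<=` P -> symb P w f -> symb Q w f.
Proof.
by move=> QP [N fs]; exists N => k; have [B B0 HB] := fs k; exists B => // x m /QP/HB.
Qed.

Let one_ge0 (h : V) : 0 <= (1 : R). Proof. exact: ler01. Qed.
Let sqr_ge0 h : 0 <= rnorm h ^+ 2. Proof. exact: exprn_ge0 (rnorm_ge0 h). Qed.

Lemma taylor_unit_ball (a : nat -> R[i]) D rho :
  symb setT (fun _ : V => 1) (fun _ => a) -> symb setT (@rnorm R n) D ->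
  symb unit_ball (fun h => rnorm h ^+ 2) rho ->
  [/\ symb unit_ball (fun _ => 1) (fun _ => a),
      symb unit_ball (fun _ => 1) D & symb unit_ball (fun _ => 1) rho].
Proof.
move=> a_s D_s rho_s; split; first exact: symb_restrict a_s.
- by apply: symb_le (symb_restrict (@subsetT _ _) D_s).
- by apply: symb_le rho_s => // h hu; rewrite exprn_ile1 // rnorm_ge0.
Qed.

Lemma taylor_symb f : taylor f -> symb unit_ball (fun _ => 1) f.
Proof.
move=> [a [D [rho [fE _ a_s D_s rho_s]]]].
have [a1 D1 rho1] := taylor_unit_ball a_s D_s rho_s.
apply: symb_ext (symbD one_ge0 (symbD one_ge0 a1 D1) rho1) => h m hu.
by rewrite fE.
Qed.

Lemma taylorM f g : taylor f -> taylor g -> taylor (fun h m => f h m * g h m).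
Proof.
move=> ft gt; have fs := taylor_symb ft.
move: ft gt => [a [D [rho [fE Dl a_s D_s rho_s]]]].
move=> [a' [D' [rho' [gE Dl' a_s' D_s' rho_s']]]].
have [a1 D1 rho1] := taylor_unit_ball a_s D_s rho_s.
have [a1' D1' rho1'] := taylor_unit_ball a_s' D_s' rho_s'.
have g1 := symbD one_ge0 (symbD one_ge0 a1' D1') rho1'.
exists (fun m => a m * a' m), (fun h m => a m * D' h m + a' m * D h m).
(* Keeping [f] whole against [rho'] leaves three terms, each quadratically small. *)
exists (fun h m => D h m * D' h m + f h m * rho' h m + rho h m * (a' m + D' h m)).
have rn0 := @rnorm_ge0 R n.
split.
- by move=> h m hu; rewrite fE // gE //; ring.
- by move=> c h h' m; rewrite Dl Dl'; ring.
- by apply: symb_le (symbM one_ge0 a_s a_s') => h _; rewrite mul1r.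
- apply: symbD => //.
    by apply: symb_le (symbM one_ge0 a_s D_s') => h _; rewrite mul1r.
  by apply: symb_le (symbM one_ge0 a_s' D_s) => h _; rewrite mul1r.
- apply: symbD => //; first apply: symbD => //.
  + apply: symb_restrict (@subsetT _ _) _.
    by apply: symb_le (symbM rn0 D_s D_s') => h _; rewrite expr2.
  + by apply: symb_le (symbM one_ge0 fs rho_s') => h _; rewrite mul1r.
  + apply: symb_le (symbM sqr_ge0 rho_s (symbD one_ge0 a1' D1')) => h _.
    by rewrite mulr1.
Qed.

Lemma taylor_abel_sum z f : normc z = 1 -> z != 1 -> taylor f ->
  taylor (fun h => abel_sum z (f h)).
Proof.
move=> z1 zn1 [a [D [rho [fE Dl a_s D_s rho_s]]]].
have [a1 D1 rho1] := taylor_unit_ball a_s D_s rho_s.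
have rn0 := @rnorm_ge0 R n.
exists (abel_sum z a), (fun h => abel_sum z (D h)), (fun h => abel_sum z (rho h)).
split.
- move=> h m hu.
  have -> : f h = fun m => 1 * rho h m + (1 * a m + D h m).
    by apply/funext => k; rewrite fE //; ring.
  have aD : symb unit_ball (fun=> 1) (fun h m => 1 * a m + D h m).
    by apply: symb_ext (symbD one_ge0 a1 D1) => k j _; rewrite mul1r.
  rewrite (abel_sum_linear z1 zn1 1 one_ge0 one_ge0 hu hu rho1 aD).
  rewrite (abel_sum_linear z1 zn1 1 one_ge0 one_ge0 hu hu a1 D1).
  by ring.
- move=> c h h' m.
  have -> : D (c *: h + h') = fun m => c * D h m + D h' m.
    by apply/funext => k; rewrite Dl.
  by rewrite (@abel_sum_linear _ _ z1 zn1 _ _ setT setT _ _ D D h h' c rn0 rn0).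
- exact: (@symb_abel_sum _ _ z1 zn1 _ _ _ one_ge0 (fun _ => a)).
- exact: symb_abel_sum.
- exact: symb_abel_sum.
Qed.

Lemma taylor_eval f m : taylor f -> exists D (B B' : R),
  [/\ forall c h h', D (c *: h + h') = c * D h + D h',
      forall h, normc (D h) <= B' * rnorm h &
      forall h, rnorm h <= 1 ->
        normc (f h m - f 0 m - D h) <= B * rnorm h ^+ 2].
Proof.
move=> [a [D [rho [fE Dl a_s [N D_s] [N' rho_s]]]]].
have [B' B'0 HB'] := D_s 0%N; have [B B0 HB] := rho_s 0%N.
have m1 k : 1 <= m.+1%:R ^+ k :> R by rewrite exprn_ege1 // ler1n.
(* [D] vanishes at 0 by linearity and [rho] by its weight, so the constant part is the value of [f]
   at 0. *)
have D00 : D 0 m = 0.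
  by have := Dl (-1) 0 0 m; rewrite scaler0 addr0 mulN1r addNr.
have rn00 : rnorm (0 : V) = 0 by rewrite /rnorm normr0.
have rho0 : rho 0 m = 0.
  apply: eq0_normc; apply/eqP; rewrite eq_le normc_ge0 andbT.
  have := HB 0 m; rewrite /unit_ball /= rn00 ler01 expr0n mulr0 mul0r mulr1.
  exact.
exists (fun h => D h m), (B * m.+1%:R ^+ N'), (B' * m.+1%:R ^+ N).
split=> [c h h'|h|h h1]; first exact: Dl.
  by have := HB' h m I; rewrite mulr1 mulrAC.
have -> : f h m - f 0 m - D h m = rho h m.
  by rewrite !fE // ?rn00 ?ler01 // D00 rho0; ring.
by have := HB h m h1; rewrite mulr1 mulrAC.
Qed.

Lemma taylor_power (a : R) (s0 : V) i : 0 <= a ->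
  taylor (fun h m => cexp (- ((s0 + h) ord0 i * (ln (m.+1%:R + a))%:C%C))).
Proof.
move=> a0; set s := s0 ord0 i; have rn0 := @rnorm_ge0 R n.
pose y m : R := m.+1%:R + a.
(* [La] is y^-s ln y, the negated derivative of y^-(s + h) at h = 0. As a difference of two
   remainders at h = -1, which still satisfies |h| <= 1, it is a symbol without any new estimate. *)
pose La m := pow_rem 1 s (-1) (y m) - pow_rem 2 s (-1) (y m).
have pw I u : (I <= 2)%N -> (forall h, normc (u h) <= 1) ->
    symb setT (fun _ : V => 1) (fun h m => pow_rem I s (u h) (y m)).
  move=> I2 u1.
  have := @symb_comp _ _ V _ setT _ _ u (fun h _ => u1 h) (symb_pow_rem s I2 a0).
  by apply: symb_le => h _ /=; rewrite exprn_ile1 ?normc_ge0.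
have pwc I c : (I <= 2)%N -> normc c <= 1 ->
    symb setT (fun _ : V => 1) (fun _ m => pow_rem I s c (y m)).
  by move=> I2 c1; apply: pw.
have n1 : normc (-1 : R[i]) <= 1 by rewrite normcN (@normc1 R).
have n0 : normc (0 : R[i]) <= 1 by rewrite (@normc0 R).
have Las : symb setT (fun _ : V => 1) (fun _ => La).
  have := symbD one_ge0 (pwc 1%N _ isT n1) (symbZ (-1) (pwc 2%N _ isT n1)).
  by apply: symb_ext => h m _; rewrite mulN1r.
exists (fun m => pow_rem 0 s 0 (y m)), (fun h m => - h ord0 i * La m).
exists (fun h m => pow_rem 2 s (h ord0 i) (y m)).
split.
- move=> h m _; rewrite mxE -/s /La /pow_rem /= -/(y m).
  rewrite mulrDl opprD cexpD !mulN1r mul0r oppr0 cexp0 opprK.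
  by ring.
- by move=> c h h' m; rewrite !mxE; ring.
- exact: pwc.
- have c_le h : setT h -> normc (- h ord0 i) <= rnorm h.
    by rewrite normcN normc_le_rnorm.
  by apply: symb_le (symb_coef c_le Las) => h _; rewrite mulr1.
- have u1 h : unit_ball h -> normc (h ord0 i) <= 1.
    by move=> hu; apply: le_trans (normc_le_rnorm h i) hu.
  have := symb_comp (u := fun h : V => h ord0 i) u1 (symb_pow_rem s (leqnn 2) a0).
  by apply: symb_le => h _ /=;
    rewrite lerXn2r ?nnegrE ?normc_ge0 ?rnorm_ge0 // normc_le_rnorm.
Qed.

End TaylorFamilies.

Section UnitCircle.
Context {R : realType}.
Implicit Types a b : R.

Lemma normc_unit_e a : normc (unit_e a) = 1.
Proof. by rewrite normc_cexp expR0. Qed.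

Lemma unit_eD a b : unit_e (a + b) = unit_e a * unit_e b.
Proof.
rewrite -cexpD; congr cexp; apply/eqP.
by rewrite eq_complex /= addr0 eqxx mulrDr /=.
Qed.

Lemma unit_e_natM a k : unit_e (a * k%:R) = unit_e a ^+ k.
Proof.
elim: k => [|k IHk]; first by rewrite mulr0 expr0 /unit_e mulr0 cexp0.
by rewrite -natr1 mulrDr mulr1 unit_eD IHk exprSr.
Qed.

(** The real part of e(a) is 1 - 2 sin(pi a)^2. Since sin^2 has period pi, [a] may be replaced by
    its fractional part [b], and 0 < b < 1 gives sin(pi b) > 0. *)
Lemma unit_e_neq1 a : 0 <= a -> a \isn't a Num.int -> unit_e a != 1.
Proof.
move=> a0 aint; pose k := Num.truncn a; pose b := a - k%:R.
have := truncn_itv a0; rewrite -/k => /andP[ka ak].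
have b0 : b != 0.
  apply: contra aint; rewrite subr_eq0 => /eqP ->.
  exact: (natr_int R k).
have sin0 : sin (pi * a) ^+ 2 = sin (pi * b) ^+ 2 :> R.
  have -> : pi * a = pi * b + k%:R * pi by rewrite /b; ring.
  elim: (k) => [|j IHj]; first by rewrite mul0r addr0.
  by rewrite -natr1 [(j%:R + 1) * _]mulrDl mul1r addrA sinDpi sqrrN.
apply/eqP => /(congr1 (@complex.Re R)).
rewrite /unit_e /cexp /= expR0 mul0r subr0 mul1r.
have -> : 2 * pi * a = (pi * a) *+ 2 by rewrite -mulr_natl; ring.
rewrite cos_mulr2n cos2sin2 sin0 => eq1.
have : 0 < sin (pi * b) ^+ 2.
  rewrite exprn_gt0 // sin_gt0_pi // mulr_gt0 ?pi_gt0 ?lt0r ?b0 ?subr_ge0 //=.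
  by rewrite gtr_pMr ?pi_gt0 // /b -natr1 in ak *; lra.
by rewrite -mulr_natl in eq1; lra.
Qed.

End UnitCircle.

(** * The continued function *)

Section Continuation.
Context {R : realType} {n : nat} (lambda alpha : 'I_n.+1 -> R).
Hypotheses (lambda_ge0 : forall i, 0 <= lambda i)
  (alpha_ge0 : forall i, 0 <= alpha i)
  (mu_notint : forall i, partial_mu lambda i \isn't a Num.int).
Local Notation V := 'rV[R[i]]_n.+1.
Implicit Types (s : V) (i : nat).

(** Natural-number indices let the recursion run freely. Beyond n, [inord] falls back to index 0, a
    case that [lerch_ext] never reaches. *)
Definition power_seq s i m : R[i] :=
  cexp (- (s ord0 (inord i) * (ln (m.+1%:R + alpha (inord i)))%:C%C)).

Definition phase i : R[i] := unit_e (partial_mu lambda (inord i)).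

(* Iterated summation, starting from the outermost (largest) index, with the
   accumulated phase factored out: [m] stands for the index [m.+1]. *)
Fixpoint iter_sum s i : nat -> R[i] :=
  match i with
  | 0 => power_seq s 0
  | i'.+1 => fun m => abel_sum (phase i') (iter_sum s i') m * power_seq s i'.+1 m
  end.

(** With z the last phase and f the last sequence, the total is the sum of z^(m+1) f(m) over m >= 0,
    whereas [abel_sum] at 0 begins with z f(1): hence the separate first term and the outer factor
    z. *)
Definition lerch_ext s : R[i] :=
  phase n * (iter_sum s n 0%N + abel_sum (phase n) (iter_sum s n) 0%N).

Lemma normc_phase i : normc (phase i) = 1.
Proof. exact: normc_unit_e. Qed.

Lemma phase_neq1 i : phase i != 1.
Proof. by apply: unit_e_neq1 (mu_notint _); apply: sumr_ge0. Qed.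

Lemma taylor_iter_sum s i : taylor (fun h => iter_sum (s + h) i).
Proof.
elim: i => [|i IHi]; first exact: taylor_power.
apply: taylorM; last exact: taylor_power.
exact: (taylor_abel_sum (normc_phase i) (phase_neq1 i) IHi).
Qed.

Lemma holomorphic_lerch_ext : holomorphic_on [set: V] lerch_ext.
Proof.
move=> s _.
have diff (f : V -> nat -> R[i]) : taylor (fun h => f (s + h)) ->
    differentiable (fun s => f s 0%N) s.
  move=> /(taylor_eval 0)[D [B [B' [Dl D_le f_le]]]].
  apply: (differentiable_quadratic Dl D_le (B := B)) => h.
  by rewrite -{2}(addr0 s); exact: f_le.
have d1 := diff (fun s => iter_sum s n) (taylor_iter_sum s n).
have d2 := diff (fun s => abel_sum (phase n) (iter_sum s n))
  (taylor_abel_sum (normc_phase n) (phase_neq1 n) (taylor_iter_sum s n)).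
exact: (differentiableZ (phase n) (differentiableD d1 d2)).
Qed.

End Continuation.

(** * Absolutely convergent nested sums *)

(* The sum of [u 0 k_0 * ... * u i.-1 k_(i.-1)] over
   [M > k_0 > ... > k_(i.-1) > m]. *)
Fixpoint nested_sum (A : pzSemiRingType) (u : nat -> nat -> A) (M i m : nat) : A :=
  match i with
  | 0 => 1
  | i'.+1 => \sum_(m.+1 <= k < M) u i' k * nested_sum u M i' k
  end.

Section NestedSums.
Context {R : realType} (u : nat -> nat -> R[i]).
Let v i k := normc (u i k).

Lemma nested_sum_rec (M i m : nat) : (m.+1 < M)%N -> nested_sum u M i.+1 m =
  u i m.+1 * nested_sum u M i m.+1 + nested_sum u M i.+1 m.+1.
Proof. by move=> mM; rewrite /= big_ltn. Qed.

Lemma normc_nested_sum M i m : normc (nested_sum u M i m) <= nested_sum v M i m.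
Proof.
elim: i m => [|i IHi] m /=.
  by rewrite le_eqVlt; apply/orP; left; apply/eqP/normc1.
apply: le_trans (normc_sum _ _ _) _; apply: ler_sum => k _.
by rewrite normcM ler_wpM2l ?normc_ge0.
Qed.

(** The tuples that [M'] adds to [M] are the same on both sides, so this is the triangle inequality
    over them. It supplies the majorant for [clim_cauchy]. *)
Lemma normc_nested_sumB M M' i m : (M <= M')%N ->
  normc (nested_sum u M' i m - nested_sum u M i m) <=
  nested_sum v M' i m - nested_sum v M i m.
Proof.
move=> MM; elim: i m => [|i IHi] m /=.
  by rewrite !subrr le_eqVlt; apply/orP; left; apply/eqP/normc0.
have tail j : normc (\sum_(j <= k < M') u i k * nested_sum u M' i k) <=
    \sum_(j <= k < M') v i k * nested_sum v M' i k.
  apply: le_trans (normc_sum _ _ _) _; apply: ler_sum => k _.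
  by rewrite normcM ler_wpM2l ?normc_ge0 ?normc_nested_sum.
have [mM|Mm] := leqP m.+1 M; last first.
  rewrite [X in normc (_ - X)]big_geq ?[X in _ <= _ - X]big_geq ?(ltnW Mm) //.
  by rewrite !subr0.
rewrite (big_cat_nat mM MM) [X in _ <= X - _](big_cat_nat mM MM) /=.
rewrite addrAC [leRHS]addrAC -!sumrB.
apply: le_trans (normcD _ _) _; apply: lerD => //.
apply: le_trans (normc_sum _ _ _) _; apply: ler_sum => k _.
by rewrite -!mulrBr normcM ler_wpM2l ?normc_ge0.
Qed.

End NestedSums.

Section Decay.
Context {R : realType}.
Implicit Types (d x : R).

(** This is x^-d for x > 0. *)
Definition decay d x : R := expR (- d * ln x).

Lemma decay_ge0 d x : 0 <= decay d x. Proof. exact: expR_ge0. Qed.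

Lemma decayD d d' x : decay (d + d') x = decay d x * decay d' x.
Proof. by rewrite -expRD; congr expR; ring. Qed.

Lemma decay_mono d x y : 0 <= d -> 0 < x -> x <= y -> decay d y <= decay d x.
Proof.
move=> d0 x0 xy; rewrite ler_expR !mulNr lerN2 ler_wpM2l //.
by rewrite ler_ln ?posrE // (lt_le_trans x0).
Qed.

Lemma decay_double d x y : 0 < x -> x <= y -> y <= 2 * x ->
  decay d y <= expR (`|d| * ln 2) * decay d x.
Proof.
move=> x0 xy y2; rewrite -expRD ler_expR.
have y0 : 0 < y by lra.
have h1 : ln x <= ln y by rewrite ler_ln ?posrE.
have h2 : ln y <= ln 2 + ln x by rewrite -lnM ?posrE // ler_ln ?posrE // mulr_gt0.
have h3 := ler_norm d; have h4 := ler_norm (- d); rewrite normrN in h4.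
have h5 := normr_ge0 d; nra.
Qed.

(** Put t = ln((x + 1) / x). The inequality e^u >= 1 + u at u = -t gives t >= 1/(x + 1); at u = d t
    it bounds the difference of powers below by d t (x + 1)^-d. *)
Lemma decay_telescope d x : 0 < d -> 1 <= x ->
  d * decay (d + 1) (x + 1) <= decay d x - decay d (x + 1).
Proof.
move=> d0 x1; have x0 : 0 < x by lra.
have x10 : 0 < x + 1 by lra.
pose t := ln (x + 1) - ln x.
have tE : expR (- t) = x / (x + 1).
  by rewrite /t opprB expRB !lnK ?posrE.
have t_ge : 1 / (x + 1) <= t.
  have := expR_ge1Dx (- t); rewrite tE.
  have -> : x / (x + 1) = 1 - 1 / (x + 1) by field; lra.
  by lra.
have dx : decay d x = decay d (x + 1) * expR (d * t).
  by rewrite -expRD /t; congr expR; ring.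
have d1 : decay (d + 1) (x + 1) = decay d (x + 1) * (1 / (x + 1)).
  by rewrite decayD {2}/decay mulN1r expRN lnK ?posrE // div1r.
have D0 := decay_ge0 d (x + 1).
rewrite dx d1; set p := 1 / (x + 1) in t_ge *.
have le_e : d * p <= expR (d * t) - 1.
  by have := expR_ge1Dx (d * t); have := ler_wpM2l (ltW d0) t_ge; lra.
by have := ler_wpM2l D0 le_e; lra.
Qed.

Lemma sum_decay_le d M m : 0 < d ->
  \sum_(m.+1 <= k < M) decay (d + 1) k%:R <=
  expR ((d + 1) * ln 2) / d * decay d m.+1%:R.
Proof.
move=> d0; pose c := expR ((d + 1) * ln 2) / d.
have c0 : 0 <= c by rewrite divr_ge0 ?expR_ge0 ?ltW.
suff H : forall j, \sum_(m.+1 <= k < (m.+1 + j)%N) decay (d + 1) k%:R <=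
    c * (decay d m.+1%:R - decay d (m.+1 + j)%:R).
  have [mM|Mm] := leqP m.+1 M; last first.
    by rewrite big_geq ?(ltnW Mm) // mulr_ge0 ?decay_ge0.
  rewrite -(subnKC mM); apply: le_trans (H _) _.
  by rewrite ler_wpM2l // gerBl decay_ge0.
elim=> [|j IHj]; first by rewrite addn0 big_geq // subrr mulr0.
rewrite addnS big_nat_recr ?leq_addr //=.
set k := (m.+1 + j)%N; have k1 : 1 <= k%:R :> R by rewrite ler1n.
have tel := decay_telescope d0 k1; rewrite natr1 in tel.
(* The telescoping estimate concerns k + 1; returning to k costs 2^(d + 1), by k + 1 <= 2 k. *)
have dbl : decay (d + 1) k%:R <= expR ((d + 1) * ln 2) * decay (d + 1) k.+1%:R.
  rewrite -ler_pdivrMl ?expR_gt0 // -expRN -expRD ler_expR.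
  have : ln k.+1%:R <= ln 2 + ln k%:R :> R.
    rewrite -lnM ?posrE ?ltr0n // ler_ln ?posrE -?natrM ?ltr0n ?muln_gt0 ?ler_nat //.
    by rewrite /k; lia.
  by nra.
have le2 : decay (d + 1) k%:R <= c * (decay d k%:R - decay d k.+1%:R).
  apply: le_trans dbl _; rewrite /c -mulrA ler_wpM2l ?expR_ge0 //.
  by rewrite ler_pdivlMl.
apply: le_trans (lerD IHj le2) _; rewrite -mulrDr ler_wpM2l //; lra.
Qed.

Lemma decay_clim0 d (g : nat -> R[i]) (C : R) : 0 < d ->
  (forall m, normc (g m) <= C * decay d m.+1%:R) -> clim g 0.
Proof.
move=> d0 g_le e e0.
have C0 : 0 <= C.
  have := le_trans (normc_ge0 _) (g_le 0%N).
  by rewrite /decay ln1 mulr0 expR0 mulr1.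
(* [x] solves x^-d = e / (C + 1); the added 1 covers C = 0. *)
pose x := expR (ln ((C + 1) / e) / d); exists (Num.bound x) => m xm.
have x0 : 0 < x by exact: expR_gt0.
have xm' : x < m.+1%:R.
  have /archi_boundP h : 0 <= x by exact: ltW.
  by apply: lt_le_trans h _; rewrite ler_nat (leq_trans xm).
have C10 : 0 < C + 1 by lra.
rewrite subr0; apply: le_lt_trans (g_le m) _.
apply: le_lt_trans (_ : C * decay d x < e).
  by rewrite ler_wpM2l // decay_mono // ltW.
have -> : decay d x = e / (C + 1).
  rewrite /decay expRK mulNr mulrC divfK ?gt_eqF //.
  by rewrite -lnV ?posrE ?divr_gt0 // lnK ?posrE ?invf_div ?divr_gt0.
by rewrite mulrA ltr_pdivrMr //; nra.
Qed.

End Decay.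

Lemma big_ord_prefix (A : nmodType) n (F : 'I_n.+1 -> A) i : (i <= n)%N ->
  \sum_(j < n.+1 | (j <= i)%N) F j = \sum_(j < i.+1) F (inord j).
Proof.
move=> i_n; rewrite (big_ord_widen n.+1 (fun j => F (inord j))) //.
by apply: eq_big => [j|j _]; rewrite ?ltnS // inord_val.
Qed.

(** * Agreement with the series on the domain *)

Section Agreement.
Context {R : realType} {n : nat} (lambda alpha : 'I_n.+1 -> R).
Hypotheses (lambda_ge0 : forall i, 0 <= lambda i)
  (alpha01 : forall i, 0 <= alpha i < 1)
  (mu_notint : forall i, partial_mu lambda i \isn't a Num.int).
Context (s : 'rV[R[i]]_n.+1) (s_dom : lerch_domain s).

Let z := phase lambda.
Let f := iter_sum lambda alpha s.

Definition lerch_factor (i : 'I_n.+1) (k : nat) : R[i] :=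
  unit_e (lambda i * k%:R) / cpow (k%:R + alpha i) (s ord0 i).

Let u i := lerch_factor (inord i).
Let v i k := normc (u i k).
Let sigma i := complex.Re (s ord0 (inord i)).
(** The decay exponent of the sum over the first [i] indices; [s_dom] says exactly that it is
    positive for 1 <= i <= n + 1. *)
Let delta i : R := \sum_(j < i) (sigma j - 1).

Lemma delta_gt0 i : (i < n.+1)%N -> 0 < delta i.+1.
Proof.
move=> i_n; have := s_dom (inord i); rewrite inordK // big_ord_prefix //.
rewrite (_ : complex.Re _ = \sum_(j < i.+1) sigma j); last first.
  by elim/big_rec2: _ => // j a b _ <-; rewrite Re_add.
by rewrite /delta sumrB subr_gt0 sumr_const card_ord.
Qed.

Lemma normc_factor i k : (0 < k)%N ->
  v i k <= expR (`|sigma i| * ln 2) * decay (sigma i) k%:R.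
Proof.
move=> k0; have k1 : 1 <= k%:R :> R by rewrite ler1n.
have /andP[a0 a1] := alpha01 (inord i).
have -> : v i k = decay (sigma i) (k%:R + alpha (inord i)).
  rewrite /v /u normcM normc_unit_e mul1r -cexpN normc_cexp /decay /sigma.
  by case: (s _ _) => a b /=; rewrite mulr0 subr0 mulNr.
by apply: decay_double; lra.
Qed.

(** The summand is O(k^-(sigma_i + delta_i)), and sigma_i + delta_i = delta_(i+1) + 1, so summing
    over k > m returns m^-delta_(i+1). A single sigma_i with i > 0 may well be negative. [B] is
    uniform in [M]. *)
Lemma nested_sum_le i : (i <= n.+1)%N -> exists2 B : R, 0 <= B &
  forall M m, nested_sum v M i m <= B * decay (delta i) m.+1%:R.
Proof.
elim: i => [|i IHi] i_n.
  exists 1 => // M m; rewrite /delta big_ord0 /decay oppr0 mul0r expR0 mulr1 /=.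
  exact: lexx.
have [B B0 HB] := IHi (ltnW i_n).
pose K := expR (`|sigma i| * ln 2); have K0 : 0 <= K by exact: expR_ge0.
have d0 := delta_gt0 i_n.
have di0 : 0 <= delta i.
  by case: (i) i_n => [|j] j_n; [rewrite /delta big_ord0|exact/ltW/delta_gt0/ltnW].
exists (K * B * (expR ((delta i.+1 + 1) * ln 2) / delta i.+1)).
  by apply: mulr_ge0; [exact: mulr_ge0|rewrite divr_ge0 ?expR_ge0 ?ltW].
move=> M m; rewrite -mulrA.
apply: le_trans (_ : K * B * \sum_(m.+1 <= k < M) decay (delta i.+1 + 1) k%:R <= _).
  rewrite /= mulr_sumr; apply: ler_sum_nat => k /andP[mk _].
  have k0 : (0 < k)%N by exact: leq_ltn_trans mk.
  have -> : delta i.+1 + 1 = sigma i + delta i.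
    by rewrite /delta big_ord_recr /=; ring.
  rewrite decayD mulrACA; apply: ler_pM; rewrite ?normc_ge0 //.
  - by apply: le_trans (normc_nested_sum _ _ _ _); exact: normc_ge0.
  - exact: normc_factor.
  - apply: le_trans (HB M k) _; rewrite ler_wpM2l //.
    by rewrite decay_mono // ?ltr0n // ler_nat.
by rewrite ler_wpM2l ?mulr_ge0 // sum_decay_le.
Qed.

Lemma nested_sum_cauchy i m : (i <= n.+1)%N ->
  exists l, clim (fun M => nested_sum u M i m) l.
Proof.
move=> i_n; have [B B0 HB] := nested_sum_le i_n.
apply: (clim_cauchy (p := fun M => nested_sum v M i m)) => [M M'|M].
  exact: normc_nested_sumB.
exact: HB.
Qed.

Let nested_lim i m := xget 0 [set l | clim (fun M => nested_sum u M i m) l].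

Lemma nested_limP i m : (i <= n.+1)%N ->
  clim (fun M => nested_sum u M i m) (nested_lim i m).
Proof.
move=> i_n; have [l ul] := nested_sum_cauchy m i_n.
by rewrite /nested_lim; case: xgetP => [y _|/(_ l)].
Qed.

Lemma nested_lim_rec i m : (i < n.+1)%N -> nested_lim i.+1 m =
  u i m.+1 * nested_lim i m.+1 + nested_lim i.+1 m.+1.
Proof.
move=> i_n; apply: clim_unique (nested_limP m i_n) _ => e e0.
have [M0 HM] :=
  climD (climZ (u i m.+1) (nested_limP m.+1 (ltnW i_n))) (nested_limP m.+1 i_n) e0.
exists (maxn M0 m.+2) => M; rewrite geq_max => /andP[/HM + mM].
by rewrite (nested_sum_rec u i mM).
Qed.

Lemma nested_lim_clim0 i : (i < n.+1)%N -> clim (nested_lim i.+1) 0.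
Proof.
move=> i_n; have [B B0 HB] := nested_sum_le i_n.
apply: (decay_clim0 (delta_gt0 i_n)) => m.
apply: clim_normc_le (nested_limP m i_n) _ => M.
exact: le_trans (normc_nested_sum _ _ _ _) (HB M m).
Qed.

Lemma phase_neq0 i : z i != 0.
Proof. exact: cexp_neq0. Qed.

Lemma factorE i m : u i m.+1 =
  unit_e (lambda (inord i)) ^+ m.+1 * power_seq alpha s i m.
Proof. by rewrite /u /lerch_factor unit_e_natM -cexpN. Qed.

Lemma phase0 : z 0 = unit_e (lambda (inord 0)).
Proof.
rewrite /z /phase /partial_mu inordK // big_ord_prefix //.
by rewrite big_ord_recl big_ord0 addr0.
Qed.

Lemma phaseS i : (i < n)%N -> z i.+1 = z i * unit_e (lambda (inord i.+1)).
Proof.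
move=> i_n; rewrite /z /phase /partial_mu !inordK ?ltnS ?(ltnW i_n) //.
rewrite !big_ord_prefix ?(ltnW i_n) // big_ord_recr /= unit_eD.
by [].
Qed.

(** On the domain the ordinary tails tend to 0, hence are tame with k = 0. Division by z^(m+1) turns
    [nested_lim_rec] into the equation of [abel_sum], and uniqueness identifies the two. *)
Lemma abel_sum_nested_lim i : (i <= n)%N ->
  (forall m, u i m.+1 * nested_lim i m.+1 = z i ^+ m.+1 * f i m) ->
  abel_sum (z i) (f i) = (fun m => nested_lim i.+1 m.+1 / z i ^+ m.+1).
Proof.
move=> i_n fE.
apply: (abel_sum_eq (normc_phase _ _) (phase_neq1 lambda_ge0 mu_notint _)).
  exists 0%N => e e0; have [M HM] := nested_lim_clim0 i_n e0.
  exists M => m mM; have := HM m.+1 (leqW mM); rewrite /= !subr0.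
  by rewrite normcM normcV normcX normc_phase expr1n invr1 mulr1.
move=> m; rewrite (nested_lim_rec m.+1 i_n) fE [z i ^+ m.+2]exprS -/z.
have z0 := phase_neq0 i; have zm0 : z i ^+ m.+1 != 0 by rewrite expf_neq0.
move: (z i ^+ m.+1) zm0 => zm zm0; move: (z i) z0 => zi z0.
by field; apply/andP.
Qed.

Lemma factor_nested_lim i : (i <= n)%N ->
  forall m, u i m.+1 * nested_lim i m.+1 = z i ^+ m.+1 * f i m.
Proof.
elim: i => [|i IHi] i_n m.
  have -> : nested_lim 0 m.+1 = 1.
    by apply: (clim_unique (nested_limP (i := 0) m.+1 isT)); exact: clim_cst.
  by rewrite mulr1 factorE phase0.
rewrite factorE /f /= -/f (abel_sum_nested_lim (ltnW i_n) (IHi (ltnW i_n))) phaseS //.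
rewrite [(z i * _) ^+ _]exprMn.
have zm0 : z i ^+ m.+1 != 0 by rewrite expf_neq0 ?phase_neq0.
move: (z i ^+ m.+1) (unit_e _ ^+ m.+1) zm0 => zm e zm0.
by field.
Qed.

Lemma nested_sum_clim :
  clim (fun M => nested_sum u M n.+1 0) (lerch_ext lambda alpha s).
Proof.
(* [abel_sum_nested_lim] covers the tails from 1 on; one step of the recursion reduces the tail at 0
   to them. *)
have := nested_limP 0 (leqnn n.+1); rewrite nested_lim_rec // factor_nested_lim // expr1.
rewrite /lerch_ext -/z -/f.
rewrite (abel_sum_nested_lim (leqnn n) (factor_nested_lim (leqnn n))) expr1.
by rewrite mulrDr [z n * (_ / _)]mulrCA divff ?phase_neq0 // mulr1.
Qed.

End Agreement.

(** * Sums over finite sets of index tuples *)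

Section UnconditionalSums.

Lemma fset_sum_split (A : nmodType) (I : choiceType) (X Y : {fset I}) (F : I -> A) :
  (X `<=` Y)%fset ->
  \sum_(i <- Y) F i = \sum_(i <- X) F i + \sum_(i <- Y | i \notin X) F i.
Proof.
move=> /fsubsetP XY; rewrite (bigID (mem X)) /=; congr (_ + _).
rewrite -big_filter; apply: perm_big; apply: uniq_perm => [||i].
- by rewrite filter_uniq // fset_uniq.
- exact: fset_uniq.
- by rewrite mem_filter /= andb_idr //; exact: XY.
Qed.

(** The absolute sums over the boxes increase to a limit [p]. If a finite [Y] contains a late box,
    its terms outside that box weigh at most the difference of two such sums, both close to [p]. *)
Lemma unconditional_sum (R : realType) (I : choiceType) (x : I -> R[i])
    (box : nat -> {fset I}) (B : R) (l : R[i]) :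
  (forall M M', (M <= M')%N -> (box M `<=` box M')%fset) ->
  (forall i, exists M, i \in box M) ->
  (forall M, \sum_(i <- box M) normc (x i) <= B) ->
  clim (fun M => \sum_(i <- box M) x i) l ->
  summability.sum (x : I -> R[i]) = l.
Proof.
move=> box_mono box_cover box_le xl.
have cover (Y : {fset I}) : exists M, (Y `<=` box M)%fset.
  elim/finSet_rect: Y => Y IH.
  have [->|[i iY]] := fset_0Vmem Y; first by exists 0%N; exact: fsub0set.
  have [|M YM] := IH (Y `\ i)%fset; first exact: fproperD1.
  have [M' iM'] := box_cover i; exists (maxn M M').
  rewrite -(fsetD1K iY) fsubUset fsub1set.
  rewrite (fsubsetP (box_mono _ _ (leq_maxr M M'))) //=.
  exact: fsubset_trans YM (box_mono _ _ (leq_maxl M M')).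
pose P M := \sum_(i <- box M) normc (x i).
have P_nd (X Y : {fset I}) : (X `<=` Y)%fset ->
    \sum_(i <- X) normc (x i) <= \sum_(i <- Y) normc (x i).
  by move=> /fset_sum_split ->; rewrite lerDl sumr_ge0 // => i _; exact: normc_ge0.
have [p Pp] : exists p : R, P @ \oo --> p.
  apply/cvg_ex; apply: nondecreasing_is_cvgn => [M M' /box_mono/P_nd //|].
  by exists B => _ [M _ <-]; exact: box_le.
have totally_proper := @summability.totally_filter I.
apply: norm_cvg_lim; apply/cvgrPdist_lt => e e0.
have e0' : 0 < complex.Re e by move: e0; rewrite ltcE => /andP[].
have eE : e = (complex.Re e)%:C%C by rewrite RRe_real // gtr0_real.
(* One quarter for the box sum against [l], one for each of the two absolute sums against [p]. *)
have e40 : 0 < complex.Re e / 4 by rewrite divr_gt0.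
have [M1 HM1] := xl _ e40.
move/cvgrPdist_lt: Pp => /(_ _ e40)[M2 _ HM2].
pose M := maxn M1 M2; exists (box M) => // Y /= MY.
have [M' YM'] := cover Y; pose M3 := maxn M M'.
have Y3 : (Y `<=` box M3)%fset by exact: fsubset_trans YM' (box_mono _ _ (leq_maxr _ _)).
have psE : summability.partial_sum x Y = \sum_(i <- Y) x i.
  by rewrite /summability.partial_sum big_seq_fsetE.
rewrite psE normr_normc eE ltcR.
have -> : l - \sum_(i <- Y) x i =
    - ((\sum_(i <- box M) x i - l) + \sum_(i <- Y | i \notin box M) x i).
  by rewrite (fset_sum_split _ MY); ring.
rewrite normcN; apply: le_lt_trans (normcD _ _) _.
have h1 := HM1 M (leq_maxl _ _).
have h2 := HM2 M (leq_maxr _ _).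
have h3 := HM2 M3 (leq_trans (leq_maxr _ _) (leq_maxl _ _)).
have h4 := normc_sum Y (fun i => i \notin box M) x.
have h5 := P_nd _ _ Y3; have h6 := fset_sum_split (fun i => normc (x i)) MY.
move: h2 h3; rewrite /= /P !ltr_norml => /andP[h21 h22] /andP[h31 h32].
by lra.
Qed.

End UnconditionalSums.

Section DecreasingTuples.

Definition decreasing_above (M i m : nat) (g : {ffun 'I_i -> 'I_M}) : bool :=
  [forall j, (m < g j)%N] &&
  [forall j : 'I_i, forall k : 'I_i, (j < k)%N ==> (g k < g j)%N].

(** In a decreasing tuple the appended entry is the smallest, which is the index of the outermost
    loop of [nested_sum]. *)
Definition ffun_snoc (M i : nat) (p : 'I_M * {ffun 'I_i -> 'I_M}) :
    {ffun 'I_i.+1 -> 'I_M} :=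
  [ffun j => if unlift ord_max j is Some j' then p.2 j' else p.1].

Lemma ffun_snoc_max M i (p : 'I_M * {ffun 'I_i -> 'I_M}) :
  ffun_snoc p ord_max = p.1.
Proof. by rewrite ffunE unlift_none. Qed.

Lemma ffun_snoc_lift M i (p : 'I_M * {ffun 'I_i -> 'I_M}) j :
  ffun_snoc p (lift ord_max j) = p.2 j.
Proof. by rewrite ffunE liftK. Qed.

Lemma ffun_snoc_bij M i : bijective (@ffun_snoc M i).
Proof.
exists (fun g : {ffun 'I_i.+1 -> 'I_M} =>
  (g ord_max, [ffun j => g (lift ord_max j)])).
  move=> [k g]; rewrite ffun_snoc_max; congr (_, _).
  by apply/ffunP => j; rewrite ffunE ffun_snoc_lift.
move=> g; apply/ffunP => j; rewrite ffunE.
by case: unliftP => [j' ->|->] //=; rewrite ffunE.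
Qed.

Lemma decreasing_above_snoc M i m (p : 'I_M * {ffun 'I_i -> 'I_M}) :
  decreasing_above m (ffun_snoc p) = (m < p.1)%N && decreasing_above p.1 p.2.
Proof.
apply/idP/idP.
  move=> /andP[/forallP gm /forallP gd]; apply/and3P; split.
  - by have := gm ord_max; rewrite ffun_snoc_max.
  - apply/forallP => j; have /forallP/(_ ord_max) := gd (lift ord_max j).
    by rewrite ffun_snoc_max ffun_snoc_lift lift_max ltn_ord.
  - apply/forallP => j; apply/forallP => k.
    have /forallP/(_ (lift ord_max k)) := gd (lift ord_max j).
    by rewrite !ffun_snoc_lift !lift_max.
move=> /and3P[mk /forallP gm /forallP gd]; apply/andP; split.
  apply/forallP => j; case: (unliftP ord_max j) => [j' ->|->].
    by rewrite ffun_snoc_lift (ltn_trans mk).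
  by rewrite ffun_snoc_max.
apply/forallP => j; apply/forallP => k; apply/implyP => jk.
case: (unliftP ord_max j) jk => [j' ->|->]; last first.
  by rewrite ltnNge -ltnS ltn_ord.
case: (unliftP ord_max k) => [k' ->|->]; rewrite !ffun_snoc_lift ?ffun_snoc_max //.
by rewrite !lift_max => jk; have /forallP/(_ k')/implyP := gd j'; exact.
Qed.

Lemma nested_sumE (A : comPzSemiRingType) (u : nat -> nat -> A) M i m :
  nested_sum u M i m = \sum_(g : {ffun 'I_i -> 'I_M} | decreasing_above m g)
    \prod_(j < i) u j (g j).
Proof.
elim: i m => [|i IHi] m /=.
  have g0 : {ffun 'I_0 -> 'I_M} by apply: finfun => -[].
  rewrite (big_pred1 g0) ?big_ord0 // => g.
  have -> : g = g0 by apply/ffunP => -[].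
  by rewrite /= eqxx; apply/andP; split; apply/forallP => -[].
rewrite (reindex _ (onW_bij _ (@ffun_snoc_bij M i))) /=.
rewrite (eq_bigl _ _ (@decreasing_above_snoc M i m)).
rewrite -(pair_big_dep (fun k : 'I_M => (m < k)%N) (fun k g => decreasing_above k g)
  (fun k g => \prod_(j < i.+1) u j (ffun_snoc (k, g) j))) /=.
rewrite big_geq_mkord /=; apply: eq_bigr => k _.
rewrite IHi mulr_sumr; apply: eq_bigr => g _.
rewrite big_ord_recr /= ffun_snoc_max mulrC; congr (_ * _).
apply: eq_bigr => j _; congr (u j _); rewrite -(ffun_snoc_lift (k, g)).
by congr (val (ffun_snoc _ _)); apply: val_inj; rewrite /= /bump leqNgt ltn_ord.
Qed.

End DecreasingTuples.

Section Boxes.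
Context {R : realType} {n : nat}.
Local Notation index := {k : {ffun 'I_n.+1 -> nat} | decreasing_pos k}.

Definition box_seq (M : nat) : seq index :=
  pmap insub [seq [ffun j => val (g j)] | g : {ffun 'I_n.+1 -> 'I_M}].

Definition box (M : nat) : {fset index} := [fset k in box_seq M]%fset.

Lemma mem_box M (k : index) : (k \in box M) = [forall j, (val k j < M)%N].
Proof.
rewrite inE /= mem_pmap_sub; apply/fintype.imageP/forallP => [[g _ kg] j|kM].
  by rewrite -[sval k]/(val k) kg ffunE ltn_ord.
exists [ffun j => Ordinal (kM j)] => //.
by apply/ffunP => j; rewrite !ffunE.
Qed.

(** Stated over a general semiring because it is applied both to the complex terms and to their real
    moduli. *)
Lemma sum_box (A : comPzSemiRingType) (u : 'I_n.+1 -> nat -> A) M :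
  \sum_(k <- box M) \prod_(j < n.+1) u j (val k j) =
  nested_sum (fun i => u (inord i)) M n.+1 0.
Proof.
have emb_inj : injective (fun g : {ffun 'I_n.+1 -> 'I_M} => [ffun j => val (g j)]).
  move=> g g' /ffunP gg'; apply/ffunP => j; apply: val_inj.
  by have := gg' j; rewrite !ffunE.
have box_uniq : uniq (box_seq M).
  by rewrite pmap_sub_uniq // map_inj_uniq // enum_uniq.
rewrite nested_sumE eq_big_imfset //= undup_id // map_id.
rewrite -(big_map val xpredT (fun k : {ffun 'I_n.+1 -> nat} => \prod_j u j (k j))).
rewrite /box_seq (pmap_filter (insubK _)) big_filter big_map enumT.
apply: eq_big => [g|g _].
  rewrite isSome_insub; congr (_ && _).
    by apply: eq_forallb => j; rewrite ffunE.
  by apply: eq_forallb => j; apply: eq_forallb => k; rewrite !ffunE.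
by apply: eq_bigr => j _; rewrite ffunE inord_val.
Qed.

End Boxes.

Section LerchSum.
Context {R : realType} {n : nat} (lambda alpha : 'I_n.+1 -> R).
Hypotheses (lambda_ge0 : forall i, 0 <= lambda i)
  (alpha01 : forall i, 0 <= alpha i < 1)
  (mu_notint : forall i, partial_mu lambda i \isn't a Num.int).

Lemma lerch_extE (s : 'rV[R[i]]_n.+1) : lerch_domain s ->
  lerch lambda alpha s = lerch_ext lambda alpha s.
Proof.
move=> s_dom.
have [B B0 HB] := nested_sum_le lambda alpha01 s_dom (leqnn n.+1).
apply: (@unconditional_sum _ _ _ (@box n) _) => [M M' MM|k|M|].
- apply/fsubsetP => k; rewrite !mem_box => /forallP kM; apply/forallP => j.
  exact: leq_trans (kM j) MM.
- exists (\max_j val k j).+1; rewrite mem_box; apply/forallP => j.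
  by rewrite ltnS; exact: leq_bigmax.
- under eq_bigr do rewrite normc_prod.
  rewrite (sum_box (fun i k => normc (lerch_factor lambda alpha s i k))).
  exact: HB.
- apply: clim_ext (nested_sum_clim lambda_ge0 alpha01 mu_notint s_dom) => M.
  by rewrite -(sum_box (lerch_factor lambda alpha s)).
Qed.

Lemma lerch_domain_near (s : 'rV[R[i]]_n.+1) : lerch_domain s ->
  \forall h \near (0 : 'rV[R[i]]_n.+1), lerch_domain (s + h).
Proof.
move=> s_dom.
suff near_i (i : 'I_n.+1) : \forall h \near (0 : 'rV[R[i]]_n.+1),
    i.+1%:R < complex.Re (\sum_(j < n.+1 | (j <= i)%N) (s + h) ord0 j).
  exact: filter_forall near_i.
pose S (t : 'rV[R[i]]_n.+1) := \sum_(j < n.+1 | (j <= i)%N) t ord0 j.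
(* A displacement of norm below [d] moves the partial sum by less than (n + 1) d, the margin left in
   the i-th condition. *)
pose d := (complex.Re (S s) - i.+1%:R) / n.+1%:R.
have d0 : 0 < d by rewrite divr_gt0 // subr_gt0; exact: s_dom.
apply/nbhs_norm0P; exists d%:C%C; first by rewrite /= ltcR.
move=> h /=; rewrite normr_rnorm ltcR => hd.
have -> : \sum_(j < n.+1 | (j <= i)%N) (s + h) ord0 j = S s + S h.
  by rewrite -big_split; apply: eq_bigr => j _; rewrite mxE.
have Sh : normc (S h) <= n.+1%:R * rnorm h.
  apply: le_trans (normc_sum _ _ _) _.
  apply: le_trans (_ : \sum_(j < n.+1) rnorm h <= _).
    rewrite big_mkcond; apply: ler_sum => j _.
    by case: ifP => _; [exact: normc_le_rnorm|exact: rnorm_ge0].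
  by rewrite sumr_const card_ord mulr_natl.
rewrite Re_add; have := abs_Re_le (S h); rewrite ler_norml => /andP[h1 _].
have : n.+1%:R * rnorm h < complex.Re (S s) - i.+1%:R.
  by rewrite mulrC -ltr_pdivlMr.
by lra.
Qed.

End LerchSum.

Lemma differentiable_near_eq (K : numFieldType) (V W : normedModType K)
    (f g : V -> W) x : (\forall h \near 0, f (x + h) = g (x + h)) ->
  differentiable f x -> differentiable g x.
Proof.
move=> fg fd; have fgx : f x = g x.
  by have := nbhs_singleton fg; rewrite /= addr0.
apply: (@differentiable_littleo _ _ _ _ ('d f x)) => [|e e0].
  exact: diff_continuous.
have /diff_locally/eqaddoP/(_ e e0) := fd.
apply: filterS2 fg => h fgh; rewrite -fgh -fgx.
by rewrite [x + h]addrC -addrA -opprD.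
Qed.

Theorem theorem1 (R : realType) (r : nat) (lambda alpha : 'I_r -> R)
    (r_ge1 : (1 <= r)%N)
    (lambda01 : forall i, 0 <= lambda i < 1)
    (alpha01 : forall i, 0 <= alpha i < 1)
    (mu_notint : forall i, partial_mu lambda i \isn't a Num.int) :
  holomorphic_on lerch_domain (lerch lambda alpha) /\
  exists F : 'rV[R[i]]_r -> R[i],
    holomorphic_on [set: 'rV[R[i]]_r] F /\
    (forall s, lerch_domain s -> F s = lerch lambda alpha s).
Proof.
case: r lambda alpha r_ge1 lambda01 alpha01 mu_notint => // n lambda alpha _.
move=> lambda01 alpha01 mu_notint.
have lambda_ge0 i : 0 <= lambda i by have /andP[] := lambda01 i.
have alpha_ge0 i : 0 <= alpha i by have /andP[] := alpha01 i.
have ext_hol := holomorphic_lerch_ext lambda_ge0 alpha_ge0 mu_notint.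
have extE := lerch_extE lambda_ge0 alpha01 mu_notint.
split; last by exists (lerch_ext lambda alpha); split => // s /extE.
(* Holomorphy of the series itself is inherited from the extension, with which it agrees near [s]
   because the domain is open. *)
move=> s s_dom; apply: differentiable_near_eq (ext_hol s I).
by apply: filterS (lerch_domain_near s_dom) => h /extE.
Qed.
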